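(* Let $L$ be a Laplacian on $[n]$, let $\mathcal{I}\subset[n]$ be nonempty, and let $t>0$. Let $P(t)=e^{-Lt}$, let $P_{\mathcal{I}}(t)$ be the projective compression, and let $\varepsilon_2(\mathcal{I}),\varepsilon_*(\mathcal{I})$ be the Nyström errors (all defined in the context). Then $$\|P(t)-P_{\mathcal{I}}(t)\|_2 \le \frac{3\sqrt3}{2\pi}\,\frac{\varepsilon_2(\mathcal{I})}{t}\qquad\text{and}\qquad \|P(t)-P_{\mathcal{I}}(t)\|_* \le \frac{3\sqrt3}{2\pi}\,\frac{\varepsilon_*(\mathcal{I})}{t}.$$
   Context: Let $[n]=\{1,\dots,n\}$. Let $R\in\mathbb{R}^{n\times n}$ be the rate matrix of an irreducible reversible continuous-time Markov chain on $[n]$: $R_{i,j}\ge 0$ for $i\ne j$, $R\mathbf 1=\mathbf 0$, $R$ irreducible, with unique (entrywise positive) stationary distribution $\pi$, $\mathbf 1^\top\pi=1$, $R^\top\pi=\mathbf 0$, and $\mathrm{diag}(\pi)R=R^\top\mathrm{diag}(\pi)$. Put $h:=\pi^{1/2}$ (entrywise) and $L:=-\mathrm{diag}(h)\,R\,\mathrm{diag}(h)^{-1}$. A ''Laplacian'' is any matrix $L$ arising this way; it is symmetric positive semidefinite with one-dimensional null space spanned by $h$. For $\gamma>0$ let $L_\gamma:=L+\gamma\mathbf I$, $K_\gamma:=L_\gamma^{-1}$, $V_\gamma:=\mathrm{orth}((K_\gamma)_{:,\mathcal I})$, where $\mathrm{orth}(A):=A(A^\top A)^{-1/2}$. The projective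 compression is $$P_{\mathcal I}(t):=\lim_{\gamma\to0^+}V_\gamma\exp(-V_\gamma^\top L_\gamma V_\gamma t)V_\gamma^\top ,$$ and the Nyström errors are $$\varepsilon_{2}(\mathcal I):=\lim_{\gamma\to0^+}\big\|K_\gamma-(K_\gamma)_{:,\mathcal I}(K_\gamma)_{\mathcal I,\mathcal I}^{-1}(K_\gamma)_{\mathcal I,:}\big\|_{2},\qquad \varepsilon_{*}(\mathcal I):=\lim_{\gamma\to0^+}\big\|K_\gamma-(K_\gamma)_{:,\mathcal I}(K_\gamma)_{\mathcal I,\mathcal I}^{-1}(K_\gamma)_{\mathcal I,:}\big\|_{*}.$$ These limits exist. $\|\cdot\|_2$ is the spectral norm and $\|\cdot\|_*$ the nuclear norm. *)

(* Defs.v *)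
From HB Require Import structures.
From mathcomp Require Import all_boot all_order all_algebra.
From mathcomp Require Import all_classical all_reals all_analysis.

Set Implicit Arguments.
Unset Strict Implicit.
Unset Printing Implicit Defensive.

Import Order.TTheory GRing.Theory Num.Theory.
Import numFieldNormedType.Exports.

Local Open Scope classical_set_scope.
Local Open Scope ring_scope.

Section MatrixAnalysis.
Variable R : realType.

Definition psdmx n (A : 'M[R]_n) : Prop :=
  A^T = A /\ forall x : 'cV[R]_n, 0 <= (x^T *m A *m x) 0 0.

(* The principal square root: [get] picks the only element of the set when [A]
   is positive semidefinite, and is irrelevant otherwise. *)
Definition sqrtmx n (A : 'M[R]_n) : 'M[R]_n :=
  get [set S | psdmx S /\ S *m S = A].

(* The limit is entrywise. *)
Definition expmx n (A : 'M[R]_n) : 'M[R]_n :=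
  limn (series (fun k : nat => (k`!%:R)^-1 *: (A ^+ k))).

Definition norm2 n (x : 'cV[R]_n) : R := Num.sqrt (\sum_i x i 0 ^+ 2).

Definition spectral_norm m n (A : 'M[R]_(m, n)) : R :=
  sup [set norm2 (A *m x) | x in [set x : 'cV[R]_n | norm2 x <= 1]].

(* The eigenvalues of [sqrtmx (A^T *m A)], with multiplicity, are the singular
   values of [A] (completed by zeros when [m < n]); the trace is their sum. *)
Definition nuclear_norm m n (A : 'M[R]_(m, n)) : R := \tr (sqrtmx (A^T *m A)).

Definition orthmx m n (A : 'M[R]_(m, n)) : 'M[R]_(m, n) :=
  A *m invmx (sqrtmx (A^T *m A)).

End MatrixAnalysis.

Section Laplacian.
Variable R : realType.

Record reversible_rate n (Q : 'M[R]_n) (mu : 'cV[R]_n) : Prop := {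
  rate_ge0 : forall i j, i != j -> 0 <= Q i j ;
  rate_row_sum : Q *m (const_mx 1 : 'cV[R]_n) = 0 ;
  rate_irreducible : forall i j, connect [rel k l | (k != l) && (0 < Q k l)] i j ;
  stationary_gt0 : forall i, 0 < mu i 0 ;
  stationary_sum : \sum_i mu i 0 = 1 ;
  stationary_eq : Q^T *m mu = 0 ;
  detailed_balance : diag_mx mu^T *m Q = Q^T *m diag_mx mu^T
}.

Definition is_laplacian n (L : 'M[R]_n) : Prop :=
  exists (Q : 'M[R]_n) (mu : 'cV[R]_n), reversible_rate Q mu /\
    let D := diag_mx (map_mx Num.sqrt mu)^T in L = - (D *m Q *m invmx D).

End Laplacian.

Section Compression.
Variables (R : realType) (n : nat).
Implicit Types (K L : 'M[R]_n) (I : {set 'I_n}) (g t : R).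

(* Rows and columns indexed by [I] are listed in increasing order. *)
Definition cols I K : 'M[R]_(n, #|I|) := colsub (@enum_val _ (mem I)) K.
Definition rows I K : 'M[R]_(#|I|, n) := rowsub (@enum_val _ (mem I)) K.
Definition minor I K : 'M[R]_#|I| :=
  mxsub (@enum_val _ (mem I)) (@enum_val _ (mem I)) K.

Definition shifted L g : 'M[R]_n := L + g%:M.
Definition resolvent L g : 'M[R]_n := invmx (shifted L g).
Definition basis L I g : 'M[R]_(n, #|I|) := orthmx (cols I (resolvent L g)).

Definition compression_at L I t g : 'M[R]_n :=
  let V := basis L I g in
  V *m expmx (- t *: (V^T *m shifted L g *m V)) *m V^T.

Definition proj_compression L I t : 'M[R]_n :=
  lim (compression_at L I t g @[g --> 0^'+]).

Definition nystrom_residual K I : 'M[R]_n :=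
  K - cols I K *m invmx (minor I K) *m rows I K.

Definition nystrom_error2 L I : R :=
  lim (spectral_norm (nystrom_residual (resolvent L g) I) @[g --> 0^'+]).

Definition nystrom_error_nuc L I : R :=
  lim (nuclear_norm (nystrom_residual (resolvent L g) I) @[g --> 0^'+]).

End Compression.

(* Main.v *)
(* For a shift [g > 0] put [K = L_g^-1]. The Nystrom approximation of [K] is
   [V (V^T L_g V)^-1 V^T], so the two matrices to compare are [f(K)] and
   [f(K - E)] for [f x = exp (- t / x)], where [E] is the Nystrom residual, and
   the claim is an operator Lipschitz bound for [f]. In eigenbases with
   eigenvalues [a] of [L] and [b] of [V^T L V], the difference is the entrywise
   product of [E] with the divided difference
     [a b (e^-a - e^-b) / (b - a) = int_0^1 a e^(-(1-s)a) b e^(-sb) ds]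
   (for [t = 1]). Integrating by parts on each half of [0, 1] turns this kernel
   into a rank-two term plus an integral of products of bounded functions of
   [a] and of [b]. Such a kernel acts boundedly both on the spectral and on the
   nuclear norm, here with constant [4 / (3 e) + 12 / (5 e^2) < 0.82], while
   [3 sqrt 3 / (2 pi) > 0.82].

   Let [J] be the complement of [I]. The residual is the inverse of the block
   [(L_g)_JJ] padded with zeros, and the range of [V] is the space of vectors
   annihilated by the rows [J] of [L_g]. Both remain meaningful at [g = 0], since
   irreducibility makes [L_JJ] definite, and depend continuously on [g >= 0]; so
   the limits are computed by putting [g = 0], and the residual being positive
   semidefinite its nuclear norm is its trace. *)
Require Import Defs.
From HB Require Import structures.
From mathcomp Require Import all_boot all_order all_algebra.
From mathcomp Require Import all_classical all_reals all_analysis.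
From mathcomp Require Import ring lra.
From mathcomp Require complex.

Set Implicit Arguments.
Unset Strict Implicit.
Unset Printing Implicit Defensive.

Import Order.TTheory GRing.Theory Num.Theory.
Import numFieldNormedType.Exports.
Local Open Scope ring_scope.

(** * Numerical constants *)

Section Numerics.
Context {R : realType}.
Implicit Types x s : R.

(** Stands in for integration: a pointwise bound on a derivative becomes a bound on an increment,
    first for Taylor estimates, later for the path part of the kernel. *)
Lemma le_of_derive_ge0 (f df : R -> R) x :
  (forall y : R, is_derive y (1 : R) f (df y)) -> (forall y, 0 <= y <= x -> 0 <= df y) ->
  0 <= x -> f 0 <= f x.
Proof.
move=> fdf df0 x0.
have [|c] := @MVT_segment R f df 0 x x0 (fun y _ => fdf y).
  apply: continuous_subspaceT => y.
  by apply/differentiable_continuous/derivable1_diffP; apply: ex_derive.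
rewrite in_itv/= => c0 e.
by rewrite -subr_ge0 e subr0 mulr_ge0 ?df0.
Qed.

Lemma sin_lex x : 0 <= x -> sin x <= x.
Proof.
move=> x0; rewrite -subr_ge0.
have := @le_of_derive_ge0 (fun y => y - sin y) (fun y => 1 - cos y) x _ _ x0.
by rewrite sin0 subr0; apply=> y _; rewrite subr_ge0 cos_le1.
Qed.

Lemma cos_ge_taylor2 x : 0 <= x -> 1 - x ^+ 2 / 2 <= cos x.
Proof.
move=> x0; rewrite -subr_ge0.
have := @le_of_derive_ge0 (fun y => cos y - (1 - y ^+ 2 / 2)) (fun y => y - sin y) x _ _ x0.
rewrite cos0 expr0n/= mul0r subr0 subrr; apply=> [y|y /andP[y0 _]]; last by rewrite subr_ge0 sin_lex.
apply: is_derive_eq.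
by rewrite /GRing.scale/=; field.
Qed.

Lemma sin_ge_taylor3 x : 0 <= x -> x - x ^+ 3 / 6 <= sin x.
Proof.
move=> x0; rewrite -subr_ge0.
have := @le_of_derive_ge0 (fun y => sin y - (y - y ^+ 3 / 6)) (fun y => cos y - (1 - y ^+ 2 / 2)) x _ _ x0.
rewrite sin0 expr0n/= mul0r !subrr; apply=> [y|y /andP[y0 _]]; last by rewrite subr_ge0 cos_ge_taylor2.
apply: is_derive_eq.
by rewrite /GRing.scale/=; field.
Qed.

Lemma sin_pi6 : sin (pi / 6) = 2^-1 :> R.
Proof.
have hp : 0 < (pi : R) by exact: pi_gt0.
have s0 : 0 < sin (pi / 6 : R) by apply: sin_gt0_pihalf; lra.
set s : R := sin _ in s0 *.
have c2 : cos (pi / 6) ^+ 2 = 1 - s ^+ 2 :> R by rewrite cos2sin2.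
have : sin (pi / 2) = 1 :> R := sin_pihalf R.
rewrite (_ : pi / 2 = pi / 6 *+ 2 + pi / 6); last by field.
rewrite sinD sin_mulr2n cos_mulr2n -/s => h.
(* The triple angle formula at [pi / 6] gives [4 s^3 - 3 s + 1 = 0], which has this factorization;
   positivity of [s] excludes the root [-1]. *)
have h3 : (2 * s - 1) ^+ 2 * (s + 1) = 0.
  move: h; set c := cos _ in c2 *.
  have -> : (c * s) *+ 2 * c + (c ^+ 2 *+ 2 - 1) * s = (c ^+ 2) * s *+ 4 - s by ring.
  rewrite c2 => h; rewrite -[RHS](subrr 1) -[X in _ = _ - X]h; ring.
move/eqP: h3; rewrite mulf_eq0 sqrf_eq0 => /orP[/eqP|/eqP] h3; lra.
Qed.

Lemma pi_le_63_20 : pi <= 63 / 20 :> R.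
Proof.
rewrite leNgt; apply/negP => h.
have p4 : pi / 2 < 2 :> R := pihalf_lt2 R.
(* [21 / 40] is one sixth of [63 / 20], and the cubic Taylor bound already puts its sine above
   [1 / 2]. *)
have lt : sin (21 / 40) < sin (pi / 6) :> R.
  by rewrite ltr_sin ?in_itv/=; lra.
have : (21 / 40) - (21 / 40) ^+ 3 / 6 <= sin (21 / 40) :> R.
  by apply: sin_ge_taylor3; lra.
move: lt; rewrite sin_pi6; lra.
Qed.

Lemma expR1_ge : 65 / 24 <= expR 1 :> R.
Proof.
(* [1 + 1 + 1/2 + 1/6 + 1/24]. *)
have -> : 65 / 24 = series (exp_coeff (1 : R)) 5.
  by rewrite /series /exp_coeff/= !big_nat_recr//= big_geq// !expr1n !factS fact0; field.
apply: nondecreasing_cvgn_le; last exact: is_cvg_series_exp_coeff.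
apply: nondecreasing_series => k _ _.
by rewrite /exp_coeff/= divr_ge0 ?ler0n// exprn_ge0.
Qed.

(* [4 / (3 e)] bounds the rank-two part of the kernel, and the integral of
   [1 - 8 s / 5] over [0, 1/2] is [3 / 10]. *)
Definition lip_const : R := 4 / (3 * expR 1) + 2 * (4 / expR 1 ^+ 2 * (3 / 10)).

Lemma lip_const_ge0 : 0 <= lip_const.
Proof.
have e0 := @expR_ge0 R 1.
by rewrite addr_ge0 ?mulr_ge0 ?invr_ge0 ?exprn_ge0 ?mulr_ge0.
Qed.

(** With [e >= 65/24], [pi <= 63/20] and [sqrt 3 >= 19/11] this is rational arithmetic; the
    remaining margin is about 0.003. *)
Lemma lip_const_le : lip_const <= 3 * Num.sqrt 3 / (2 * pi).
Proof.
have e := expR1_ge; have p := pi_le_63_20; have p0 : 0 < (pi : R) := pi_gt0 R.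
have s3 : 19 / 11 <= Num.sqrt 3 :> R.
  rewrite -[leLHS]ger0_norm; last by lra.
  by rewrite -sqrtr_sqr ler_wsqrtr//; lra.
have h1 : 3 * (19 / 11) / (2 * (63 / 20)) <= 3 * Num.sqrt 3 / (2 * pi) :> R.
  apply: (@le_trans _ _ (3 * (19 / 11) / (2 * pi))).
    by rewrite ler_pM2l ?lef_pV2 ?posrE; lra.
  by rewrite ler_pM2r ?invr_gt0; lra.
apply: le_trans h1; rewrite /lip_const.
have h2 : 4 / (3 * expR 1) <= 4 / (3 * (65 / 24)) :> R.
  by rewrite ler_pM2l ?lef_pV2 ?posrE; lra.
have h3 : 4 / (expR 1 ^+ 2) <= 4 / (65 / 24) ^+ 2 :> R.
  by rewrite ler_pM2l ?lef_pV2 ?posrE ?exprn_gt0 ?ler_sqr ?nnegrE; lra.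
lra.
Qed.

End Numerics.

(** * Scalar bounds on the factors of the kernel *)

Section Kernel.
Context {R : realType}.
Implicit Types (x s a b : R) (u v : option R).

Lemma mulr_expRN_le x : x * expR (- x) <= (expR 1)^-1.
Proof.
rewrite -ler_pdivlMr ?expR_gt0// -expRN -expRB opprK.
by have := expR_ge1Dx (- 1 + x); lra.
Qed.

Lemma expRN_le_inv x : 0 <= x -> expR (- x) <= (1 + x)^-1.
Proof.
move=> x0; rewrite expRN lef_pV2 ?posrE ?expR_gt0 ?expR_ge1Dx//; lra.
Qed.

(* Eigenvalues of the compressed operator live in [option R]: [None] stands for
   [+oo], the value on the orthogonal complement of the range of [V]. *)
Definition gval u := if u is Some a then a * expR (- a) else 0.
Definition kval u := if u is Some a then 1 - expR (- (a / 2)) else 1.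
(** [gpath] is the [s]-derivative of [a e^(-(1-s)a)]. [kpath] has [s]-derivative [- b e^(-sb)] and
    is normalized to vanish at [s = 1/2], so integration by parts on [0, 1/2] leaves only the
    boundary term [gval u * kval v] at [s = 0]. *)
Definition gpath s u := if u is Some a then a ^+ 2 * expR (- ((1 - s) * a)) else 0.
Definition kpath s u := if u is Some a then expR (- (s * a)) - expR (- (a / 2)) else 0.

Definition ext_nonneg u := if u is Some a then 0 <= a else true.

(** Places the rescaled pair in the unit disc, so that the rank-two part of the kernel costs only
    [4 / (3 e)]. With [y = e^(-a/2)] and [z = 3 a / 4], the first square is [(e z e^(-z))^2 y <= y],
    and [y + (1 - y)^2 <= 1] on [0, 1]. *)
Lemma gval_kval_le u : ext_nonneg u ->
  (3 * expR 1 / 4 * gval u) ^+ 2 + kval u ^+ 2 <= 1.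
Proof.
case: u => [a|] /= a0; last by lra.
set y := expR (- (a / 2)).
have y0 : 0 < y := expR_gt0 _.
have y1 : y <= 1 by rewrite /y expR_le1; lra.
have -> : expR (- a) = y ^+ 2 by rewrite expr2 -expRD; congr expR; field.
pose z := 3 / 4 * a.
have := mulr_expRN_le z; set w := expR (- z) => zw.
have yw : y ^+ 3 = w ^+ 2.
  by rewrite /y /w -!expRM_natl; congr expR; rewrite /z; field.
have z0 : 0 <= z by rewrite /z; lra.
have w0 : 0 < w := expR_gt0 _.
have ezw : (expR 1 * z * w) ^+ 2 <= 1.
  rewrite -[leRHS](expr1n _ 2) ler_sqr ?nnegrE ?mulr_ge0 ?expR_ge0//.
  by rewrite -mulrA mulrC -ler_pdivlMr ?expR_gt0 // mul1r.
have -> : (3 * expR 1 / 4 * (a * y ^+ 2)) ^+ 2 = (expR 1 * z) ^+ 2 * y ^+ 3 * y.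
  by rewrite /z; field.
rewrite yw -exprMn.
have : (expR 1 * z * w) ^+ 2 * y <= y by rewrite ler_piMl// ltW.
nra.
Qed.

Lemma gpath_ge0 s u : 0 <= gpath s u.
Proof. by case: u => //= a; rewrite mulr_ge0 ?expR_ge0 ?sqr_ge0. Qed.

(** Up to the factor [4 / (1 - s)^2] this is the square of [z e^(-z)] at [z = (1 - s) a / 2]. *)
Lemma gpath_le s u : ext_nonneg u -> 0 <= s <= 1 / 2 ->
  gpath s u <= 4 / expR 1 ^+ 2 / (1 - s) ^+ 2.
Proof.
move=> + s01; have e0 := @expR_gt0 R 1.
have s1 : 0 < 1 - s by lra.
case: u => [a|] /= a0; last by rewrite !divr_ge0// sqr_ge0.
rewrite ler_pdivlMr ?exprn_gt0//.
pose z := (1 - s) * a / 2.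
have z0 : 0 <= z by rewrite /z divr_ge0// mulr_ge0// ltW.
have -> : expR (- ((1 - s) * a)) = expR (- z) ^+ 2.
  by rewrite -expRM_natl; congr expR; rewrite /z; field.
have -> : a ^+ 2 * expR (- z) ^+ 2 * (1 - s) ^+ 2 = 4 * (z * expR (- z)) ^+ 2.
  by rewrite /z; field.
rewrite -exprVn ler_pM2l// ler_sqr ?nnegrE ?invr_ge0 ?expR_ge0 //.
  exact: mulr_expRN_le.
by rewrite (mulr_ge0 z0) ?expR_ge0.
Qed.

Lemma kpath_ge0 s u : ext_nonneg u -> 0 <= s <= 1 / 2 -> 0 <= kpath s u.
Proof.
case: u => [a|] //= a0 s01; rewrite subr_ge0 ler_expR lerN2.
nra.
Qed.

(* Convexity of [exp] along [- r x = r (1 - r - x) + (1 - r) (- r)], where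
   [r = 2 s] and [x = a / 2]. *)
Lemma kpath_le s u : ext_nonneg u -> 0 <= s <= 1 / 2 ->
  kpath s u <= (1 - 2 * s) / (1 + 2 * s).
Proof.
move=> + s01; case: u => [a|] /= a0; last by apply: divr_ge0; lra.
pose r := 2 * s; pose x := a / 2.
have -> : s * a = r * x by rewrite /r /x; field.
rewrite -/r -/x; have r01 : 0 <= r <= 1 by rewrite /r; lra.
have w0 := expR_gt0 (- (r * x)); set w := expR (- (r * x)) in w0 *.
have h1 : w * (1 + (1 - r) * (1 - x)) <= expR (1 - r - x).
  have -> : 1 - r - x = - (r * x) + (1 - r) * (1 - x) by ring.
  by rewrite expRD ler_pM2l ?expR_ge1Dx.
have h2 : w * (1 + r * (x - 1)) <= expR (- r).
  have -> : - r = - (r * x) + r * (x - 1) by ring.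
  by rewrite expRD ler_pM2l ?expR_ge1Dx.
have h3 : r * expR (1 - r - x) <= expR (- x).
  have := expR_ge1Dx (r - 1); rewrite (_ : 1 + (r - 1) = r) => [h|]; last by ring.
  have -> : expR (- x) = expR (r - 1) * expR (1 - r - x).
    by rewrite -expRD; congr expR; ring.
  by rewrite ler_pM2r ?expR_gt0.
have h4 : expR (- r) <= (1 + r)^-1 by apply: expRN_le_inv; lra.
have : (1 - r) * expR (- r) <= (1 - r) / (1 + r) by rewrite ler_wpM2l//; lra.
nra.
Qed.

(** Replaces the product of the two path bounds by a linear function of [s], whose primitive is
    elementary. *)
Lemma path_bound_le s : 0 <= s <= 1 / 2 ->
  4 / expR 1 ^+ 2 / (1 - s) ^+ 2 * ((1 - 2 * s) / (1 + 2 * s)) <=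
  4 / expR 1 ^+ 2 * (1 - 8 / 5 * s).
Proof.
move=> s01; rewrite -[leLHS]mulrA.
rewrite ler_pM2l ?divr_gt0 ?exprn_gt0 ?expR_gt0//.
rewrite mulrA ler_pdivrMr; last by lra.
rewrite [leLHS]mulrC ler_pdivrMr ?exprn_gt0//; last by lra.
rewrite -subr_ge0.
have -> : (1 - 8 / 5 * s) * (1 + 2 * s) * (1 - s) ^+ 2 - (1 - 2 * s) =
  s * (2 / 5 - 3 * s + 34 / 5 * s ^+ 2 - 16 / 5 * s ^+ 3) by field.
apply: mulr_ge0; first by lra.
have h1 : 0 <= (1 / 2 - s) * (s - 3 / 10) ^+ 2.
  by rewrite mulr_ge0 ?sqr_ge0//; lra.
have h2 := sqr_ge0 (s - 4 / 15).
(* Positivity certificate on [0, 1/2]: two nonnegative terms with nodes near the minimum of the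
   cubic, plus a linear remainder that stays positive. *)
have -> : 2 / 5 - 3 * s + 34 / 5 * s ^+ 2 - 16 / 5 * s ^+ 3 =
  16 / 5 * ((1 / 2 - s) * (s - 3 / 10) ^+ 2) + 82 / 25 * (s - 4 / 15) ^+ 2 +
  (64 / 250 - 82 / 25 * (4 / 15) ^+ 2 - s * (219 / 125 - 656 / 375)) by field.
lra.
Qed.

End Kernel.

(** * The Schur multiplier *)

Section Schur.
Context {R : realType}.
Implicit Types (s a b : R) (u v : option R).

(* The divided difference of [x |-> exp (- 1 / x)] at [1 / a] and [1 / b]. *)
Definition exp_kernel u v : R :=
  match u, v with
  | Some a, Some b => if a == b then a ^+ 2 * expR (- a)
                      else a * b * (expR (- a) - expR (- b)) / (b - a)
  | Some a, None | None, Some a => a * expR (- a)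
  | None, None => 0
  end.

(** Closed primitive in [s] of [gpath s u * kpath s v], whose first term has the exponent
    [s (a - b) - a] and becomes linear in [s] when [a = b]. An infinite argument makes the integrand
    vanish. *)
Definition path_prim u v s : R :=
  if u is Some a then
    if v is Some b then
      a ^+ 2 * expR (- a) * (if a == b then s else expR (s * (a - b)) / (a - b))
      - a * expR (- ((1 - s) * a)) * expR (- (b / 2))
    else 0
  else 0.

Lemma is_derive_expRM (c d s : R) :
  is_derive s (1 : R) (fun x => expR (c * x + d)) (c * expR (c * s + d)).
Proof.
have h : is_derive s (1 : R) (fun x => c * x + d) c.
  by apply: is_derive_eq; rewrite /GRing.scale/=; ring.
have := @is_derive1_comp R expR (fun x => c * x + d) s _ _ (is_derive_expR _) h.
by rewrite mulrC.
Qed.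

Lemma is_derive_path_prim u v s :
  is_derive s (1 : R) (path_prim u v) (gpath s u * kpath s v).
Proof.
case: u v => [a|] [b|]; rewrite /gpath /kpath ?mul0r ?mulr0; try exact: is_derive_cst.
have h1 := is_derive_expRM a (- a) s.
have h2 := is_derive_expRM (a - b) 0 s.
have [<-|ab] := eqVneq a b.
- have -> : path_prim (Some a) (Some a) = fun x : R =>
      a ^+ 2 * expR (- a) * x - a * expR (- (a / 2)) * expR (a * x - a).
    apply/funext => x; rewrite /path_prim eqxx; congr (_ - _).
    rewrite mulrAC; congr (_ * expR _); ring.
  apply: is_derive_eq; rewrite /GRing.scale/=.
  have -> : - ((1 - s) * a) = a * s - a by ring.
  rewrite mulrBr -[X in _ = X - _]mulrA -expRD.
  have -> : a * s - a - s * a = - a by ring.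
  ring.
- have -> : path_prim (Some a) (Some b) = fun x : R =>
      a ^+ 2 * expR (- a) / (a - b) * expR ((a - b) * x + 0) -
      a * expR (- (b / 2)) * expR (a * x - a).
    apply/funext => x; rewrite /path_prim (negPf ab); congr (_ - _).
      have -> : (a - b) * x + 0 = x * (a - b) by ring.
      ring.
    rewrite mulrAC; congr (_ * expR _); ring.
  apply: is_derive_eq; rewrite /GRing.scale/=.
  have -> : - ((1 - s) * a) = a * s - a by ring.
  rewrite mulrBr -[X in _ = X - _]mulrA -expRD.
  have -> : a * s - a - s * b = - a + (a - b) * s by ring.
  have ab0 : a - b != 0 by rewrite subr_eq0.
  by rewrite addr0 (expRD (- a)); field.
Qed.

(* Integration by parts of [int_0^1 a e^(-(1-s)a) b e^(-sb) ds], separately on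
   [0, 1/2] and on [1/2, 1]. *)
Lemma exp_kernelE u v :
  exp_kernel u v = gval u * kval v + kval u * gval v +
    (path_prim u v (1 / 2) - path_prim u v 0) +
    (path_prim v u (1 / 2) - path_prim v u 0).
Proof.
case: u v => [a|] [b|] /=;
  try by rewrite !(subr0, addr0, mul0r, mulr0, mul1r, mulr1, add0r).
have ea : expR (- a) = expR (- (a / 2)) ^+ 2.
  by rewrite -expRM_natl; congr expR; field.
have eb : expR (- b) = expR (- (b / 2)) ^+ 2.
  by rewrite -expRM_natl; congr expR; field.
have ha : expR (- ((1 - 1 / 2) * a)) = expR (- (a / 2)) by congr expR; field.
have hb : expR (- ((1 - 1 / 2) * b)) = expR (- (b / 2)) by congr expR; field.
rewrite ha hb !subr0 !mul1r !mul0r expR0 ea eb.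
rewrite (eq_sym b a); have [<-|ab] := eqVneq a b; first by field.
have za : expR (- (a / 2)) != 0 by rewrite expR_eq0.
have zb : expR (- (b / 2)) != 0 by rewrite expR_eq0.
have -> : expR (2^-1 * (a - b)) = expR (- (b / 2)) / expR (- (a / 2)).
  by rewrite -expRB; congr expR; field.
have -> : expR (2^-1 * (b - a)) = expR (- (a / 2)) / expR (- (b / 2)).
  by rewrite -expRB; congr expR; field.
by field; rewrite za zb !subr_eq0 ab eq_sym ab.
Qed.

Variables (m n : nat).
Implicit Types (B : 'M[R]_(m, n)) (x : 'I_m -> R) (y : 'I_n -> R).

Definition bilin B x y : R := \sum_i \sum_j x i * B i j * y j.
Definition energy x y : R := (\sum_i x i ^+ 2 + \sum_j y j ^+ 2) / 2.

(* Applied to [c x] and [y / c] with the optimal [c], this is the usual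
   [|x^T B y| <= |x| |y|]. *)
Definition contractive B := forall x y, bilin B x y <= energy x y.

Lemma contractive_scale B x y (u : 'I_m -> R) (v : 'I_n -> R) G K :
  contractive B -> (forall i, `|u i| <= G) -> (forall j, `|v j| <= K) ->
  0 <= G -> 0 <= K ->
  bilin B (fun i => u i * x i) (fun j => v j * y j) <= G * K * energy x y.
Proof.
move=> cB uG vK G0 K0.
pose x' i := u i / G * x i; pose y' j := v j / K * y j.
have -> : bilin B (fun i => u i * x i) (fun j => v j * y j) = G * K * bilin B x' y'.
  rewrite /bilin mulr_sumr; apply: eq_bigr => i _.
  rewrite mulr_sumr; apply: eq_bigr => j _; rewrite /x' /y'.
  (* If [G = 0] the bound forces [u i = 0], so the identity survives the convention that the inverse
     of 0 is 0; likewise for [K]. *)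
  have -> : u i = u i / G * G.
    have [z|z] := eqVneq G 0; last by rewrite divfK.
    by have := uG i; rewrite z normr_le0 => /eqP ->; rewrite mulr0.
  have -> : v j = v j / K * K.
    have [z|z] := eqVneq K 0; last by rewrite divfK.
    by have := vK j; rewrite z normr_le0 => /eqP ->; rewrite mulr0.
  have [->|z] := eqVneq G 0; first by rewrite !(mulr0, mul0r).
  have [->|z'] := eqVneq K 0; first by rewrite !(mulr0, mul0r).
  by rewrite !mulfK //; ring.
apply: ler_wpM2l; first exact: mulr_ge0.
apply: (le_trans (cB _ _)); rewrite /energy ler_pM2r//.
have h (w c : R) (z : R) : `|w| <= c -> 0 <= c -> (w / c * z) ^+ 2 <= z ^+ 2.
  move=> wc c0; rewrite exprMn ler_piMl ?sqr_ge0//.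
  rewrite -real_normK ?num_real// expr_le1// normrM normfV (ger0_norm c0).
  have [->|cz] := eqVneq c 0; first by rewrite invr0 mulr0.
  by rewrite ler_pdivrMr ?mul1r// lt_def cz.
by apply: lerD; apply: ler_sum => k _; apply: h.
Qed.

Lemma is_derive_sum2 (f df : 'I_m -> 'I_n -> R -> R) s :
  (forall i j, is_derive s (1 : R) (f i j) (df i j s)) ->
  is_derive s (1 : R) (fun t => \sum_i \sum_j f i j t) (\sum_i \sum_j df i j s).
Proof.
move=> h.
have -> : (fun t => \sum_i \sum_j f i j t) = \sum_i \sum_j f i j.
  apply/funext => t; rewrite fct_sumE; apply: eq_bigr => i _.
  by rewrite fct_sumE.
by apply: is_derive_sum => i; apply: is_derive_sum.
Qed.

(** [exp_kernelE] splits the sum into a rank-two part and the increment over [0, 1/2] of a function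
    [F]. The first is bounded through the unit disc, the second by bounding [F'] by products of
    suprema. *)
Theorem schur_kernel B x y (a : 'I_m -> option R) (b : 'I_n -> option R) :
  contractive B -> (forall i, ext_nonneg (a i)) -> (forall j, ext_nonneg (b j)) ->
  \sum_i \sum_j exp_kernel (a i) (b j) * (x i * B i j * y j)
    <= lip_const * energy x y.
Proof.
move=> cB a0 b0; set N := energy x y.
have N0 : 0 <= N by rewrite /N /energy divr_ge0// addr_ge0//; apply: sumr_ge0 => k _; apply: sqr_ge0.
have e0 := @expR_gt0 R 1.
pose c := 3 * expR 1 / 4 : R.
pose R1 := bilin B (fun i => c * gval (a i) * x i) (fun j => kval (b j) * y j).
pose R2 := bilin B (fun i => kval (a i) * x i) (fun j => c * gval (b j) * y j).
(* Both energies are added before estimating: each [x k ^+ 2] and [y k ^+ 2] then carries the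
   coefficient of [gval_kval_le], giving [N] rather than [2 N]. *)
have hR : R1 + R2 <= N.
  apply: (le_trans (lerD (cB _ _) (cB _ _))).
  rewrite /N /energy -mulrDl ler_pM2r// addrACA -!big_split/=.
  apply: lerD; apply: ler_sum => k _.
    rewrite !(exprMn _ _ (x k)) -mulrDl ler_piMl ?sqr_ge0//.
    exact: gval_kval_le.
  rewrite !(exprMn _ _ (y k)) -mulrDl ler_piMl ?sqr_ge0// addrC.
  exact: gval_kval_le.
pose f i j s := (path_prim (a i) (b j) s + path_prim (b j) (a i) s) * (x i * B i j * y j).
pose df i j s := (gpath s (a i) * kpath s (b j) + gpath s (b j) * kpath s (a i)) *
   (x i * B i j * y j).
pose F s := \sum_i \sum_j f i j s.
have hF s : is_derive s (1 : R) F (\sum_i \sum_j df i j s).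
  apply: is_derive_sum2 => i j.
  have h1 := is_derive_path_prim (a i) (b j) s.
  have h2 := is_derive_path_prim (b j) (a i) s.
  by apply: is_derive_eq; rewrite /GRing.scale/= /df; ring.
(* The factor 2 accounts for the two halves of [0, 1], which have exchanged roles of [a] and [b]. *)
pose C : R := 2 * (4 / expR 1 ^+ 2) * N.
have hdF s : 0 <= s <= 1 / 2 -> \sum_i \sum_j df i j s <= C * (1 - 8 / 5 * s).
  move=> s01.
  set G := 4 / expR 1 ^+ 2 / (1 - s) ^+ 2; set K := (1 - 2 * s) / (1 + 2 * s).
  have G0 : 0 <= G by rewrite !divr_ge0 ?sqr_ge0// ltW.
  have K0 : 0 <= K by apply: divr_ge0; lra.
  have gG u : ext_nonneg u -> `|gpath s u| <= G.
    by move=> u0; rewrite ger0_norm ?gpath_ge0// gpath_le.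
  have kK u : ext_nonneg u -> `|kpath s u| <= K.
    by move=> u0; rewrite ger0_norm ?kpath_ge0// kpath_le.
  have -> : \sum_i \sum_j df i j s =
     bilin B (fun i => gpath s (a i) * x i) (fun j => kpath s (b j) * y j) +
     bilin B (fun i => kpath s (a i) * x i) (fun j => gpath s (b j) * y j).
    rewrite /bilin -big_split; apply: eq_bigr => i _ /=.
    rewrite -big_split; apply: eq_bigr => j _ /=.
    by rewrite /df; ring.
  have h1 : bilin B (fun i => gpath s (a i) * x i) (fun j => kpath s (b j) * y j)
      <= G * K * N by apply: contractive_scale => // k; [exact: gG|exact: kK].
  have h2 : bilin B (fun i => kpath s (a i) * x i) (fun j => gpath s (b j) * y j)
      <= K * G * N by apply: contractive_scale => // k; [exact: kK|exact: gG].
  have h3 := path_bound_le s01; rewrite -/G -/K in h3.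
  have h4 : G * K * N <= 4 / expR 1 ^+ 2 * (1 - 8 / 5 * s) * N by exact: ler_wpM2r.
  apply: (le_trans (lerD h1 h2)).
  by rewrite (mulrC K) /C; lra.
have hFF : F (1 / 2) - F 0 <= C * (3 / 10).
  have h := @le_of_derive_ge0 R (fun s => C * (s - 4 / 5 * s ^+ 2) - F s)
    (fun s => C * (1 - 8 / 5 * s) - \sum_i \sum_j df i j s) (1 / 2).
  have := h _ _ _; rewrite expr0n/= !(mulr0, subr0) sub0r.
  have -> : C * (1 / 2 - 4 / 5 * (1 / 2) ^+ 2) = C * (3 / 10) by field.
  move=> hh; suff : - F 0 <= C * (3 / 10) - F (1 / 2) by lra.
  apply: hh => [s|s s01|]; last by lra.
    have ? := hF s; apply: is_derive_eq; rewrite /GRing.scale/=; ring.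
  by rewrite subr_ge0 hdF.
have -> : \sum_i \sum_j exp_kernel (a i) (b j) * (x i * B i j * y j) =
    c^-1 * (R1 + R2) + (F (1 / 2) - F 0).
  rewrite /R1 /R2 /F /bilin -sumrB -!big_split mulr_sumr -big_split; apply: eq_bigr => i _ /=.
  rewrite -sumrB -!big_split mulr_sumr -big_split; apply: eq_bigr => j _ /=.
  rewrite exp_kernelE /f /c; field; rewrite gt_eqF//.
have hc : c^-1 * (R1 + R2) <= c^-1 * N by rewrite ler_pM2l// invr_gt0 /c; lra.
apply: (le_trans (lerD hc hFF)).
rewrite /lip_const /C /c.
have -> : (3 * expR 1 / 4)^-1 = 4 / (3 * expR 1) :> R by rewrite invf_div.
lra.
Qed.

End Schur.

(** * Symmetric matrices *)

Section Spectral.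
Import complex.
Context {R : rcfType}.

Lemma dotmx_ge0 n (v : 'rV[R]_n) : 0 <= (v *m v^T) 0 0.
Proof. by rewrite mxE; apply: sumr_ge0 => i _; rewrite mxE -expr2 sqr_ge0. Qed.

Lemma dotmx_eq0 n (v : 'rV[R]_n) : ((v *m v^T) 0 0 == 0) = (v == 0).
Proof.
apply/idP/eqP => [|->]; last by rewrite mul0mx mxE.
rewrite mxE psumr_eq0 => [/allP h|i _]; last by rewrite mxE -expr2 sqr_ge0.
apply/rowP => i; have := h i (mem_index_enum i).
by rewrite !mxE -expr2 sqrf_eq0 => /eqP.
Qed.

(** Over the complex numbers there is an eigenvector [x + i y] with eigenvalue [a + i b]. Symmetry
    gives [b (|x|^2 + |y|^2) = 0], so [b = 0] and whichever of [x], [y] is nonzero is a real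
    eigenvector. *)
Lemma symmx_eigenvector n (A : 'M[R]_n.+1) : A^T = A ->
  exists2 v : 'rV[R]_n.+1, v != 0 & exists a, v *m A = a *: v.
Proof.
move=> symA.
pose toC := complex.real_complex R : R -> complex.complex R.
pose AC := map_mx toC A.
have [l] : exists l, root (char_poly AC) l.
  by apply: closed_rootP; rewrite size_char_poly.
rewrite -eigenvalue_root_char => /eigenvalueP [w Aw w0].
pose x := map_mx (@complex.Re R) w; pose y := map_mx (@complex.Im R) w.
case: l Aw => a b Aw.
have ReM (p q : complex.complex R) : complex.Re (p * q) =
    complex.Re p * complex.Re q - complex.Im p * complex.Im q by case: p; case: q.
have ImM (p q : complex.complex R) : complex.Im (p * q) =
    complex.Re p * complex.Im q + complex.Im p * complex.Re q by case: p; case: q.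
have ReS (I : finType) (F : I -> complex.complex R) :
    complex.Re (\sum_i F i) = \sum_i complex.Re (F i).
  by apply: (big_morph (@complex.Re R)) => // -[p q] [r s].
have ImS (I : finType) (F : I -> complex.complex R) :
    complex.Im (\sum_i F i) = \sum_i complex.Im (F i).
  by apply: (big_morph (@complex.Im R)) => // -[p q] [r s].
have xA : x *m A = a *: x - b *: y.
  apply/rowP => i; have /rowP/(_ i)/(congr1 (@complex.Re R)) := Aw.
  rewrite !mxE ReS ReM => h; rewrite -h; apply: eq_bigr => j _.
  by rewrite !mxE ReM /= mulr0 subr0.
have yA : y *m A = a *: y + b *: x.
  apply/rowP => i; have /rowP/(_ i)/(congr1 (@complex.Im R)) := Aw.
  rewrite !mxE ImS ImM => h; rewrite -h; apply: eq_bigr => j _.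
  by rewrite !mxE ImM /= mulr0 add0r.
have b0 : b * ((x *m x^T) 0 0 + (y *m y^T) 0 0) = 0.
  have : (x *m A *m y^T) 0 0 = (y *m A *m x^T) 0 0.
    by rewrite -[in LHS](trmxK (x *m A *m y^T)) mxE !trmx_mul trmxK symA mulmxA.
  rewrite xA yA mulmxBl mulmxDl -!scalemxAl !mxE => h.
  have hxy : \sum_j x 0 j * y^T j 0 = \sum_j y 0 j * x^T j 0.
    by apply: eq_bigr => j _; rewrite !mxE mulrC.
  move: h; rewrite hxy; lra.
have xy0 : (x != 0) || (y != 0).
  apply: contraNT w0; rewrite negb_or !negbK => /andP[/eqP x0 /eqP y0].
  apply/eqP/rowP => i; move/rowP/(_ i): x0; move/rowP/(_ i): y0; rewrite !mxE.
  by case: (w 0 i) => p q /= -> ->.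
have s0 : (x *m x^T) 0 0 + (y *m y^T) 0 0 != 0.
  apply: contraL xy0; rewrite paddr_eq0 ?dotmx_ge0// !dotmx_eq0.
  by rewrite negb_or !negbK.
move/eqP: b0; rewrite mulf_eq0 (negPf s0) orbF => /eqP b0.
case/orP: xy0 => nz; [exists x => //|exists y => //]; exists a.
  by rewrite xA b0 scale0r subr0.
by rewrite yA b0 scale0r addr0.
Qed.

(** The reflection along [w = e - v] exchanges the unit vectors [e] and [v], because [e . w] is half
    of [|w|^2]. *)
Lemma householder n (v : 'rV[R]_n.+1) : v *m v^T = 1%:M ->
  exists H : 'M[R]_n.+1, [/\ H^T = H, H *m H = 1%:M & delta_mx 0 0 *m H = v].
Proof.
move=> v1; pose e : 'rV[R]_n.+1 := delta_mx 0 0.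
have [->|ve] := eqVneq v e.
  by exists 1%:M; rewrite trmx1 mulmx1; split=> //; rewrite mulmx1.
have [w we] : {w | w = e - v} by exists (e - v).
pose c := (w *m w^T) 0 0.
have c0 : c != 0 by rewrite dotmx_eq0 we subr_eq0 eq_sym.
have wwT : w *m w^T = c%:M by exact: mx11_scalar.
have ee : e *m e^T = 1%:M.
  by rewrite trmx_delta mul_delta_mx; apply/matrixP => i j; rewrite !ord1 !mxE.
have evT : v *m e^T = e *m v^T.
  by apply/matrixP => i j; rewrite !ord1 !mxE; apply: eq_bigr => k _; rewrite !mxE mulrC.
have ew : e *m w^T = (c / 2)%:M.
  apply/(scalerI (a := 2)); first by rewrite pnatr_eq0.
  rewrite scale_scalar_mx mulrC divfK ?pnatr_eq0// -wwT.
  rewrite we linearB/= mulmxBl !mulmxBr ee v1 evT opprB.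
  by rewrite scaler_nat mulr2n.
exists (1%:M - (2 / c) *: (w^T *m w)); split.
- by rewrite linearB/= linearZ/= trmx_mul trmxK trmx1.
- rewrite mulmxBl mul1mx mulmxBr mulmx1 -!scalemxAr -!scalemxAl scalerA.
  rewrite (mulmxA (w^T *m w)) -(mulmxA w^T w) wwT mul_mx_scalar -scalemxAl scalerA.
  rewrite opprB -addrA -!(scaleNr _ (w^T *m w)) -!scalerDl.
  by rewrite [X in X *: _](_ : _ = 0) ?scale0r ?addr0//; field.
- rewrite mulmxBr mulmx1 -scalemxAr mulmxA ew mul_scalar_mx scalerA.
  rewrite (_ : 2 / c * (c / 2) = 1); last by field.
  by rewrite scale1r we opprB addrC subrK.
Qed.

(** Induction on the size: a reflection moves a unit eigenvector to the first basis vector, after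
    which symmetry makes the matrix block diagonal. *)
Theorem symmx_spectral n (A : 'M[R]_n) : A^T = A ->
  exists U : 'M[R]_n, exists d : 'rV[R]_n,
    U *m U^T = 1%:M /\ A = U^T *m diag_mx d *m U.
Proof.
elim: n A => [|n IH] A symA.
  by exists 1%:M, 0; split; rewrite !flatmx0//; apply: flatmx0.
have [w w0 [a wA]] := symmx_eigenvector symA.
pose s := Num.sqrt ((w *m w^T) 0 0).
have s0 : s != 0.
  by rewrite sqrtr_eq0 -ltNge lt_def dotmx_eq0 w0 dotmx_ge0.
pose v := s^-1 *: w.
have vA : v *m A = a *: v by rewrite -scalemxAl wA !scalerA mulrC.
have v1 : v *m v^T = 1%:M.
  rewrite linearZ/= -scalemxAl -scalemxAr scalerA [w *m _]mx11_scalar.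
  rewrite -[(w *m w^T) 0 0]sqr_sqrtr ?dotmx_ge0// -/s scale_scalar_mx.
  by congr _%:M; rewrite expr2; field.
have [H [symH HH eH]] := householder v1.
have [B Bdef] : {B : 'M[R]_(1 + n) | B = H *m A *m H} by exists (H *m A *m H).
have symB : B^T = B by rewrite Bdef !trmx_mul symH symA mulmxA.
have eB : delta_mx 0 0 *m B = a *: (delta_mx 0 0 : 'rV[R]_(1 + n)).
  by rewrite Bdef !mulmxA eH vA -scalemxAl -eH -mulmxA HH mulmx1.
have B0 j : B 0 j = a * (j == 0)%:R.
  by move/rowP/(_ j): eB; rewrite -rowE !mxE eqxx.
have B0r i j : val i = 0%N -> B i j = a * (val j == 0%N)%:R.
  by move=> i0; rewrite (_ : i = 0) ?B0//; apply/val_inj.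
have B0c i j : val i = 0%N -> B j i = a * (val j == 0%N)%:R.
  by move=> i0; rewrite -[in LHS]symB mxE B0r.
have symA' : (drsubmx B)^T = drsubmx B by rewrite trmx_drsub symB.
have BE : B = block_mx a%:M 0 0 (drsubmx B).
  rewrite -[LHS]submxK; congr block_mx.
  - by apply/matrixP => i j; rewrite !ord1 !mxE B0r//= mulr1 mulr1n.
  - by apply/matrixP => i j; rewrite ord1 !mxE B0r//= mulr0.
  - by apply/matrixP => i j; rewrite ord1 !mxE B0c//= mulr0.
have [U [d [UU DE]]] := IH _ symA'.
suff [W [D [WW BW]]] : exists W : 'M[R]_n.+1, exists D : 'rV[R]_n.+1,
    W *m W^T = 1%:M /\ (B : 'M[R]_n.+1) = W^T *m diag_mx D *m W.
  exists (W *m H), D; split.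
    by rewrite trmx_mul symH mulmxA -(mulmxA W) HH mulmx1.
  have AE : A = H *m (B : 'M[R]_n.+1) *m H.
    by rewrite Bdef !mulmxA HH mul1mx -mulmxA HH mulmx1.
  by rewrite {1}AE BW trmx_mul symH !mulmxA.
pose W : 'M[R]_(1 + n) := block_mx 1%:M 0 0 U.
have WT : W^T = block_mx 1%:M 0 0 U^T by rewrite tr_block_mx !trmx0 trmx1.
have WW : W *m W^T = 1%:M.
  rewrite WT mulmx_block !(mulmx0, mul0mx, mul1mx, addr0, add0r) UU.
  by rewrite -scalar_mx_block.
have BW : B = W^T *m diag_mx (row_mx a%:M d) *m W.
  rewrite BE DE WT diag_mx_row !mulmx_block.
  rewrite !(mulmx0, mul0mx, mulmx1, mul1mx, addr0, add0r).
  by congr block_mx; apply/matrixP => i j; rewrite !ord1 !mxE.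
by exists W, (row_mx a%:M d).
Qed.

End Spectral.

(** * Euclidean, Frobenius and spectral norms *)

Section Norms.
Context {R : realType}.

Definition sqn n (x : 'cV[R]_n) : R := \sum_i x i 0 ^+ 2.

Lemma sqnE n (x : 'cV[R]_n) : sqn x = (x^T *m x) 0 0.
Proof. by rewrite mxE; apply: eq_bigr => i _; rewrite !mxE expr2. Qed.

Lemma sqn_ge0 n (x : 'cV[R]_n) : 0 <= sqn x.
Proof. by apply: sumr_ge0 => i _; apply: sqr_ge0. Qed.

Lemma sqn_eq0 n (x : 'cV[R]_n) : sqn x = 0 -> x = 0.
Proof.
move/eqP; rewrite psumr_eq0 => [/allP h|i _]; last exact: sqr_ge0.
apply/colP => i; have := h i (mem_index_enum i).
by rewrite sqrf_eq0 mxE => /eqP.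
Qed.

Lemma sqnZ n a (x : 'cV[R]_n) : sqn (a *: x) = a ^+ 2 * sqn x.
Proof. by rewrite mulr_sumr; apply: eq_bigr => i _; rewrite mxE exprMn. Qed.

Lemma sqn_mul_orth m n (U : 'M[R]_(m, n)) (x : 'cV[R]_n) :
  U^T *m U = 1%:M -> sqn (U *m x) = sqn x.
Proof. by move=> U1; rewrite !sqnE trmx_mul mulmxA -(mulmxA x^T) U1 mulmx1. Qed.

(** [|x - V^T V x|^2 = |x|^2 - |V x|^2]. *)
Lemma sqn_mul_coisometry m n (V : 'M[R]_(m, n)) (x : 'cV[R]_n) :
  V *m V^T = 1%:M -> sqn (V *m x) <= sqn x.
Proof.
move=> V1; have := sqn_ge0 (x - V^T *m (V *m x)).
rewrite sqnE [(_ - _)^T]linearB/= mulmxBl !mulmxBr !trmx_mul trmxK.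
have -> : x^T *m V^T *m V *m (V^T *m (V *m x)) = x^T *m V^T *m (V *m x).
  by rewrite !mulmxA -(mulmxA _ V V^T) V1 mulmx1.
rewrite !mulmxA subrr subr0 -!mulmxA mulmxA -trmx_mul.
by rewrite [sqn x]sqnE [sqn (V *m x)]sqnE ![in X in X -> _]mxE subr_ge0 !mxE.
Qed.

Lemma norm2E n (x : 'cV[R]_n) : norm2 x = Num.sqrt (sqn x).
Proof. by []. Qed.

Lemma sqr_norm2 n (x : 'cV[R]_n) : norm2 x ^+ 2 = sqn x.
Proof. by rewrite norm2E sqr_sqrtr ?sqn_ge0. Qed.

Lemma norm2_ge0 n (x : 'cV[R]_n) : 0 <= norm2 x.
Proof. exact: sqrtr_ge0. Qed.

Lemma norm2_eq0 n (x : 'cV[R]_n) : norm2 x = 0 -> x = 0.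
Proof. by move=> x0; apply: sqn_eq0; rewrite -sqr_norm2 x0 expr0n. Qed.

Lemma norm2Z n a (x : 'cV[R]_n) : norm2 (a *: x) = `|a| * norm2 x.
Proof. by rewrite !norm2E sqnZ sqrtrM ?sqr_ge0// sqrtr_sqr. Qed.

Lemma norm2_0 n : norm2 (0 : 'cV[R]_n) = 0.
Proof. by rewrite -(scale0r 0) norm2Z normr0 mul0r. Qed.

(* Scaling [x] and [y] to norm 1. *)
Lemma bilinear_bound m n (A : 'M[R]_(m, n)) c : 0 <= c ->
  (forall x y, (x^T *m A *m y) 0 0 <= c * ((sqn x + sqn y) / 2)) ->
  forall x y, (x^T *m A *m y) 0 0 <= c * (norm2 x * norm2 y).
Proof.
move=> c0 h x y.
have [x0|x0] := eqVneq (norm2 x) 0.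
  by rewrite x0 mul0r mulr0 (norm2_eq0 x0) trmx0 !mul0mx mxE.
have [y0|y0] := eqVneq (norm2 y) 0.
  by rewrite y0 !mulr0 (norm2_eq0 y0) mulmx0 mxE.
have := h ((norm2 x)^-1 *: x) ((norm2 y)^-1 *: y).
rewrite [(_ *: _)^T]linearZ/= -!scalemxAl -scalemxAr !sqnZ -!sqr_norm2 !exprVn.
rewrite !mulVf ?sqrf_eq0// => hh; rewrite [leLHS]mxE [X in _ * X <= _]mxE in hh.
rewrite -ler_pdivrMr ?mulr_gt0 ?lt_def ?x0 ?y0 ?norm2_ge0//.
rewrite invfM mulrC -mulrA; apply: (le_trans hh); lra.
Qed.

Lemma dot_le n (x y : 'cV[R]_n) : (x^T *m y) 0 0 <= norm2 x * norm2 y.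
Proof.
rewrite -[x^T]mulmx1 -[leRHS]mul1r; apply: bilinear_bound => // {}x {}y.
rewrite mulmx1 mul1r ler_pdivlMr// mxE /sqn -big_split mulr_suml.
apply: ler_sum => i _ /=; rewrite mxE; have := sqr_ge0 (x i 0 - y i 0).
rewrite sqrrB; lra.
Qed.

Lemma norm2D n (x y : 'cV[R]_n) : norm2 (x + y) <= norm2 x + norm2 y.
Proof.
rewrite -ler_sqr ?nnegrE ?addr_ge0 ?norm2_ge0// sqrrD !sqr_norm2 !sqnE.
rewrite [(_ + _)^T]linearD/= mulmxDl !mulmxDr.
have yx : (y^T *m x) 0 0 = (x^T *m y) 0 0.
  by rewrite -[in LHS](trmxK (y^T *m x)) trmx_mul trmxK mxE.
have xy := dot_le x y; rewrite [leLHS]mxE.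
rewrite [X in X + _ <= _]mxE [X in _ + X <= _]mxE yx; lra.
Qed.

(** The Frobenius norm. It bounds the set whose supremum is [spectral_norm], and it controls both
    entries and spectral norm in the continuity arguments. *)
Definition frob m n (A : 'M[R]_(m, n)) : R := Num.sqrt (\tr (A^T *m A)).

Lemma trTE m n (A : 'M[R]_(m, n)) : \tr (A^T *m A) = \sum_j \sum_i A i j ^+ 2.
Proof.
apply: eq_bigr => j _; rewrite mxE; apply: eq_bigr => i _.
by rewrite mxE expr2.
Qed.

Lemma norm2_mul_frob m n (A : 'M[R]_(m, n)) x : norm2 (A *m x) <= frob A * norm2 x.
Proof.
rewrite -ler_sqr ?nnegrE ?mulr_ge0 ?norm2_ge0 ?sqrtr_ge0//.
have trA : 0 <= \tr (A^T *m A).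
  by rewrite trTE; do 2 (apply: sumr_ge0 => ? _); apply: sqr_ge0.
rewrite exprMn !sqr_norm2 sqr_sqrtr// trTE exchange_big/= mulr_suml.
apply: ler_sum => i _.
have -> : (A *m x) i 0 = (((row i A)^T)^T *m x) 0 0.
  by rewrite trmxK !mxE; apply: eq_bigr => j _; rewrite mxE.
have -> : \sum_j A i j ^+ 2 = sqn (row i A)^T.
  by apply: eq_bigr => j _; rewrite !mxE.
rewrite -!sqr_norm2 -exprMn; set r := (row i A)^T.
rewrite -[leLHS]real_normK ?num_real// ler_sqr ?nnegrE ?mulr_ge0 ?norm2_ge0//.
rewrite ler_norml dot_le andbT lerNl.
have := dot_le (- r) x; rewrite [(- _)^T]linearN/= mulNmx mxE => h; apply: (le_trans h).
by rewrite -scaleN1r norm2Z normrN normr1 mul1r.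
Qed.

Lemma norm2_mul_le m n (A : 'M[R]_(m, n)) x :
  norm2 (A *m x) <= spectral_norm A * norm2 x.
Proof.
have [x0|x0] := eqVneq (norm2 x) 0.
  by rewrite (norm2_eq0 x0) mulmx0 !norm2_0 mulr0.
have xgt0 : 0 < norm2 x by rewrite lt_def x0 norm2_ge0.
rewrite -ler_pdivrMr// mulrC -[_^-1]gtr0_norm ?invr_gt0// -norm2Z scalemxAr.
apply: ub_le_sup; last first.
  exists ((norm2 x)^-1 *: x) => //=.
  by rewrite norm2Z gtr0_norm ?invr_gt0// mulVf.
exists (frob A) => _ [y /= y1 <-]; apply: (le_trans (norm2_mul_frob A y)).
by rewrite ler_piMr ?sqrtr_ge0.
Qed.

Lemma spectral_norm_le m n (A : 'M[R]_(m, n)) c : 0 <= c ->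
  (forall x, norm2 (A *m x) <= c * norm2 x) -> spectral_norm A <= c.
Proof.
move=> c0 h; apply: ge_sup; first by exists (norm2 (A *m 0)), 0; rewrite /= ?norm2_0.
move=> _ [y /= y1 <-]; apply: (le_trans (h y)).
by rewrite ler_piMr.
Qed.

Lemma spectral_norm_ge0 m n (A : 'M[R]_(m, n)) : 0 <= spectral_norm A.
Proof.
apply: ub_le_sup; last by exists 0; rewrite /= ?mulmx0 norm2_0.
exists (frob A) => _ [y /= y1 <-]; apply: (le_trans (norm2_mul_frob A y)).
by rewrite ler_piMr ?sqrtr_ge0.
Qed.

(** Testing the form on the pair [A *m x], [x] recovers [|A x|^2]. *)
Lemma spectral_norm_le_bilinear m n (A : 'M[R]_(m, n)) c : 0 <= c ->
  (forall x y, (x^T *m A *m y) 0 0 <= c * ((sqn x + sqn y) / 2)) ->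
  spectral_norm A <= c.
Proof.
move=> c0 h; apply: spectral_norm_le => // x.
have [z0|z0] := eqVneq (norm2 (A *m x)) 0.
  by rewrite z0 mulr_ge0 ?norm2_ge0.
have zgt0 : 0 < norm2 (A *m x) by rewrite lt_def z0 norm2_ge0.
rewrite -(ler_pM2l zgt0) -expr2 sqr_norm2 sqnE mulmxA mulrCA.
exact: bilinear_bound.
Qed.

Lemma spectral_normB_le m n (A B : 'M[R]_(m, n)) :
  `|spectral_norm A - spectral_norm B| <= frob (A - B).
Proof.
have h (C D : 'M[R]_(m, n)) : spectral_norm C - spectral_norm D <= frob (C - D).
  rewrite lerBlDl; apply: spectral_norm_le => [|x].
    by rewrite addr_ge0 ?spectral_norm_ge0 ?sqrtr_ge0.
  rewrite -{1}(subrK D C) mulmxDl addrC mulrDl.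
  apply: (le_trans (norm2D _ _)); apply: lerD; first exact: norm2_mul_le.
  exact: norm2_mul_frob.
rewrite ler_norml h andbT lerNl opprB (le_trans (h _ _))//.
by rewrite /frob -opprB [(- _)^T]linearN/= mulNmx mulmxN opprK.
Qed.

Lemma form_le_spectral_norm m n (A : 'M[R]_(m, n)) x y :
  (x^T *m A *m y) 0 0 <= spectral_norm A * ((sqn x + sqn y) / 2).
Proof.
rewrite -mulmxA; apply: (le_trans (dot_le _ _)).
apply: (@le_trans _ _ (norm2 x * (spectral_norm A * norm2 y))).
  by rewrite ler_wpM2l ?norm2_ge0 ?norm2_mul_le.
rewrite mulrCA ler_wpM2l ?spectral_norm_ge0//.
rewrite -!sqr_norm2 ler_pdivlMr//; have := sqr_ge0 (norm2 x - norm2 y).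
rewrite sqrrB; lra.
Qed.

End Norms.

(** * Functional calculus, square roots and limits of matrices *)

Section FunctionalCalculus.
Context {R : realType}.

(* For [A = conj_diag U d] with [U] orthogonal, [f(A)] is [conj_diag U (map_mx f d)]. *)
Definition conj_diag n (U : 'M[R]_n) (d : 'rV[R]_n) : 'M[R]_n :=
  U^T *m diag_mx d *m U.

Lemma conj_diagM n (U : 'M[R]_n) d e : U *m U^T = 1%:M ->
  conj_diag U d *m conj_diag U e = conj_diag U (\row_i (d 0 i * e 0 i)).
Proof.
move=> U1; rewrite /conj_diag !mulmxA -(mulmxA _ U) U1 mulmx1.
by rewrite -(mulmxA U^T) mulmx_diag.
Qed.

Lemma tr_conj_diag n (U : 'M[R]_n) d : (conj_diag U d)^T = conj_diag U d.
Proof. by rewrite !trmx_mul trmxK tr_diag_mx mulmxA. Qed.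

(** In the eigenbases the hypothesis reads [d_i c_ij = c_ij e_j]: eigenvalues agree wherever [c_ij]
    is nonzero, hence so do their images under any [f]. *)
Lemma conj_diag_intertwine m n (U : 'M[R]_m) d (V : 'M[R]_n) e (C : 'M[R]_(m, n)) f :
  U *m U^T = 1%:M -> V *m V^T = 1%:M ->
  conj_diag U d *m C = C *m conj_diag V e ->
  conj_diag U (map_mx f d) *m C = C *m conj_diag V (map_mx f e).
Proof.
move=> U1 V1 h.
have U1' := mulmx1C U1; have V1' := mulmx1C V1.
have [c cdef] : {c | c = U *m C *m V^T} by exists (U *m C *m V^T).
have cE : diag_mx d *m c = c *m diag_mx e.
  have -> : diag_mx d *m c = U *m (conj_diag U d *m C) *m V^T.
    by rewrite cdef /conj_diag !mulmxA U1 mul1mx.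
  by rewrite cdef h /conj_diag !mulmxA -(mulmxA _ V) V1 mulmx1.
have fE : diag_mx (map_mx f d) *m c = c *m diag_mx (map_mx f e).
  apply/matrixP => i j; move/matrixP/(_ i j): cE.
  rewrite !mul_diag_mx !mul_mx_diag !mxE => hij.
  have [->|c0] := eqVneq (c i j) 0; first by rewrite mulr0 mul0r.
  have -> : d 0 i = e 0 j by apply: (mulfI c0); rewrite -hij mulrC.
  by rewrite mulrC.
have CE : C = U^T *m c *m V by rewrite cdef !mulmxA U1' mul1mx -mulmxA V1' mulmx1.
rewrite CE /conj_diag.
transitivity (U^T *m (diag_mx (map_mx f d) *m c) *m V).
  by rewrite !mulmxA -(mulmxA _ U) U1 mulmx1.
by rewrite fE !mulmxA -(mulmxA _ V V^T) V1 mulmx1.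
Qed.

Lemma psd_conj_diag n (U : 'M[R]_n) (d : 'rV[R]_n) : (forall i, 0 <= d 0 i) ->
  psdmx (conj_diag U d).
Proof.
move=> d0; split=> [|x]; first exact: tr_conj_diag.
rewrite /conj_diag !mulmxA -trmx_mul -mulmxA mul_mx_diag mxE.
apply: sumr_ge0 => i _; rewrite !mxE mulrAC mulr_ge0// -expr2 sqr_ge0//.
Qed.

Lemma psd_spectral n (A : 'M[R]_n) : psdmx A ->
  exists (U : 'M[R]_n) (d : 'rV[R]_n), [/\ U *m U^T = 1%:M, A = conj_diag U d & forall i, 0 <= d 0 i].
Proof.
case=> symA posA; have [U [d [U1 AE]]] := symmx_spectral symA.
exists U, d; split=> // i.
have := posA (U^T *m delta_mx i 0).
rewrite AE trmx_mul trmxK !mulmxA -(mulmxA _ U U^T) U1 mulmx1.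
by rewrite -(mulmxA _ U U^T) U1 mulmx1 trmx_delta -rowE -colE mxE mxE mxE eqxx.
Qed.

(** Two roots have squares intertwined by the identity, and applying [Num.sqrt] to the spectra
    identifies the roots themselves. This justifies the choice made by [get]. *)
Lemma sqrtmx_unique n (S A : 'M[R]_n) : psdmx S -> S *m S = A -> sqrtmx A = S.
Proof.
move=> pS SA; apply: get_unique => // T [pT TA].
have [U [d [U1 SE d0]]] := psd_spectral pS.
have [V [e [V1 TE e0]]] := psd_spectral pT.
have h : conj_diag V (\row_i (e 0 i * e 0 i)) *m 1%:M =
    1%:M *m conj_diag U (\row_i (d 0 i * d 0 i)).
  by rewrite mulmx1 mul1mx -!conj_diagM// -SE -TE SA TA.
have := conj_diag_intertwine Num.sqrt V1 U1 h; rewrite mulmx1 mul1mx.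
have sq (v : 'rV[R]_n) : (forall i, 0 <= v 0 i) ->
    map_mx Num.sqrt (\row_i (v 0 i * v 0 i)) = v.
  by move=> v0; apply/rowP => i; rewrite !mxE -expr2 sqrtr_sqr ger0_norm.
by rewrite !sq// -SE -TE.
Qed.

Lemma sqrtmxP n (A : 'M[R]_n) : psdmx A ->
  psdmx (sqrtmx A) /\ sqrtmx A *m sqrtmx A = A.
Proof.
move=> pA; have [U [d [U1 AE d0]]] := psd_spectral pA.
pose S := conj_diag U (map_mx Num.sqrt d).
have pS : psdmx S by apply: psd_conj_diag => i; rewrite mxE sqrtr_ge0.
have SS : S *m S = A.
  rewrite conj_diagM// AE; congr conj_diag; apply/rowP => i.
  by rewrite !mxE -expr2 sqr_sqrtr.
by rewrite (sqrtmx_unique pS SS).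
Qed.

Lemma psd_gram m n (A : 'M[R]_(m, n)) : psdmx (A^T *m A).
Proof.
split=> [|x]; first by rewrite trmx_mul trmxK.
by rewrite mulmxA -trmx_mul -mulmxA -sqnE sqn_ge0.
Qed.

Lemma nuclear_norm_psd n (E : 'M[R]_n) : psdmx E -> nuclear_norm E = \tr E.
Proof.
by move=> pE; rewrite /nuclear_norm (sqrtmx_unique pE)// pE.1.
Qed.

(** [X] is the sign of [D], taken on its eigenvalues: [D *m X] is the absolute value of [D], and [X]
    is a contraction. *)
Lemma nuclear_norm_dual n (D : 'M[R]_n) : D^T = D ->
  exists2 X, nuclear_norm D = \tr (D *m X) &
    forall x y, (x^T *m X *m y) 0 0 <= (sqn x + sqn y) / 2.
Proof.
move=> symD; have [W [d [W1 DE]]] := symmx_spectral symD.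
pose X := conj_diag W (map_mx Num.sg d).
have DX : D *m X = conj_diag W (map_mx Num.norm d).
  rewrite DE conj_diagM//; congr conj_diag; apply/rowP => i.
  by rewrite !mxE normrEsg mulrC.
exists X.
  rewrite DX /nuclear_norm; congr mxtrace; apply: sqrtmx_unique.
    by apply: psd_conj_diag => i; rewrite mxE.
  rewrite symD DE !conj_diagM//; congr conj_diag; apply/rowP => i.
  by rewrite !mxE -normrM ger0_norm// -expr2 sqr_ge0.
move=> x y; have W1' := mulmx1C W1.
rewrite -(sqn_mul_orth x W1') -(sqn_mul_orth y W1').
rewrite /X /conj_diag !mulmxA -trmx_mul -mulmxA mul_mx_diag mxE /sqn -big_split.
rewrite mulr_suml; apply: ler_sum => i _ /=.
rewrite [X in X * _ <= _]mxE [X in X * _ * _ <= _]mxE [X in _ * X * _ <= _]mxE.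
set p := (W *m x) i 0; set q := (W *m y) i 0.
rewrite ler_pdivlMr//.
have h1 := sqr_ge0 (p - q); have h2 := sqr_ge0 (p + q).
rewrite sqrrB in h1; rewrite sqrrD in h2.

case: (sgrP (d 0 i)) => _; lra.
Qed.

(** The second identity gives the orthogonal projection onto the column space of [A] without a
    square root; it lets one orthonormal basis be exchanged for another. *)
Lemma orthmxP m n (A : 'M[R]_(m, n)) : A^T *m A \in unitmx ->
  (orthmx A)^T *m orthmx A = 1%:M /\
  orthmx A *m (orthmx A)^T = A *m invmx (A^T *m A) *m A^T.
Proof.
move=> uA; have [[symT _] TT] := sqrtmxP (psd_gram A).
rewrite /orthmx; set T := sqrtmx _ in symT TT *.
have uT : T \in unitmx.
  by move: uA; rewrite -TT !unitmxE det_mulmx unitrM => /andP[].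
have symTi : (invmx T)^T = invmx T by rewrite trmx_inv symT.
rewrite !trmx_mul symTi; split.
  rewrite !mulmxA -(mulmxA _ A^T) -TT mulmxA mulVmx// mul1mx mulmxV//.
rewrite !mulmxA -(mulmxA A) -TT.
suff -> : invmx T *m invmx T = invmx (T *m T) by [].
have uTT : T *m T \in unitmx by rewrite TT.
rewrite -[LHS](mulmxK uTT) (mulmxA _ T) -(mulmxA (invmx T)).
by rewrite mulVmx// mulmx1 mulVmx// mul1mx.
Qed.

Lemma cvg_mx m n {T : Type} (F : set_system T) {FF : Filter F}
    (f : T -> 'M[R]_(m, n)) (M : 'M[R]_(m, n)) :
  (forall i j, (f x i j @[x --> F] --> M i j)%classic) -> (f x @[x --> F] --> M)%classic.
Proof.
move=> h; apply/cvg_ballP => e e0.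
have hij : \forall x \near F, forall ij : 'I_m * 'I_n, ball (M ij.1 ij.2) e (f x ij.1 ij.2).
  apply: filter_forall => -[i j] /=.
  by move/cvg_ballP: (h i j); apply.
by apply: filterS hij => x hx; split=> // i j; exact: (hx (i, j)).
Qed.

Lemma cvg_mx_entry m n {T : Type} (F : set_system T) {FF : Filter F}
    (f : T -> 'M[R]_(m, n)) (M : 'M[R]_(m, n)) i j :
  (f x @[x --> F] --> M)%classic -> (f x i j @[x --> F] --> M i j)%classic.
Proof. exact: (@continuous_cvg _ _ _ F FF f (fun N : 'M[R]_(m, n) => N i j) M (@coord_continuous R m n i j M)). Qed.

Lemma cvg_big_sum {T I : Type} (F : set_system T) {FF : Filter F}
    (s : seq I) (P : pred I) (f : I -> T -> R) (l : I -> R) :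
  (forall i, (f i x @[x --> F] --> l i)%classic) ->
  (\sum_(i <- s | P i) f i x @[x --> F] --> \sum_(i <- s | P i) l i)%classic.
Proof.
move=> h; elim: s => [|i s IH].
  by rewrite big_nil; under eq_fun do rewrite big_nil; exact: cvg_cst.
rewrite big_cons; under eq_fun do rewrite big_cons.
by case: ifP => // _; apply: cvgD.
Qed.

Lemma cvg_big_prod {T I : Type} (F : set_system T) {FF : Filter F}
    (s : seq I) (P : pred I) (f : I -> T -> R) (l : I -> R) :
  (forall i, (f i x @[x --> F] --> l i)%classic) ->
  (\prod_(i <- s | P i) f i x @[x --> F] --> \prod_(i <- s | P i) l i)%classic.
Proof.
move=> h; elim: s => [|i s IH].
  by rewrite big_nil; under eq_fun do rewrite big_nil; exact: cvg_cst.
rewrite big_cons; under eq_fun do rewrite big_cons.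
by case: ifP => // _; apply: cvgM.
Qed.

Lemma cvg_mulmx m n p {T : Type} (F : set_system T) {FF : Filter F}
    (f : T -> 'M[R]_(m, n)) (g : T -> 'M[R]_(n, p))
    (A : 'M[R]_(m, n)) (B : 'M[R]_(n, p)) :
  (f x @[x --> F] --> A)%classic -> (g x @[x --> F] --> B)%classic ->
  (f x *m g x @[x --> F] --> A *m B)%classic.
Proof.
move=> fA gB; apply: cvg_mx => i j; rewrite mxE.
under eq_fun do rewrite mxE.
by apply: cvg_big_sum => k; apply: cvgM; exact: cvg_mx_entry.
Qed.

Lemma cvg_trmx m n {T : Type} (F : set_system T) {FF : Filter F}
    (f : T -> 'M[R]_(m, n)) (A : 'M[R]_(m, n)) :
  (f x @[x --> F] --> A)%classic -> ((f x)^T @[x --> F] --> A^T)%classic.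
Proof.
move=> fA; apply: cvg_mx => i j; rewrite mxE.
by under eq_fun do rewrite mxE; exact: cvg_mx_entry.
Qed.

Lemma cvg_det n {T : Type} (F : set_system T) {FF : Filter F}
    (f : T -> 'M[R]_n) (A : 'M[R]_n) :
  (f x @[x --> F] --> A)%classic -> (\det (f x) @[x --> F] --> \det A)%classic.
Proof.
move=> fA; apply: cvg_big_sum => s; apply: cvgM; first exact: cvg_cst.
by apply: cvg_big_prod => i; exact: cvg_mx_entry.
Qed.

(** By Cramer's formula the entries are cofactors divided by the determinant. Invertibility along
    the whole family keeps [invmx] away from its default value. *)
Lemma cvg_invmx n {T : Type} (F : set_system T) {FF : Filter F}
    (f : T -> 'M[R]_n) (A : 'M[R]_n) : A \in unitmx -> (forall x, f x \in unitmx) ->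
  (f x @[x --> F] --> A)%classic -> (invmx (f x) @[x --> F] --> invmx A)%classic.
Proof.
move=> uA uf fA; apply: cvg_mx => i j; rewrite /invmx uA 2!mxE.
under eq_fun do rewrite /invmx uf 2!mxE.
apply: cvgM.
  by apply: cvgV; [rewrite -unitfE -unitmxE|exact: cvg_det].
apply: cvgM; first exact: cvg_cst.
apply: cvg_det; apply: cvg_mx => k l; rewrite !mxE.
by under eq_fun do rewrite !mxE; exact: cvg_mx_entry.
Qed.

Lemma conj_diagX n (U : 'M[R]_n) d k : U *m U^T = 1%:M ->
  conj_diag U d ^+ k = conj_diag U (map_mx (fun x => x ^+ k) d).
Proof.
move=> U1; elim: k => [|k IH].
  rewrite expr0 /conj_diag (_ : map_mx _ d = const_mx 1); last first.
    by apply/rowP => i; rewrite !mxE.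
  by rewrite diag_const_mx mulmx1 (mulmx1C U1).
rewrite exprS IH -mulmxE conj_diagM//; congr conj_diag.
by apply/rowP => i; rewrite !mxE exprS.
Qed.

Lemma expmx_conj_diag n (U : 'M[R]_n) d : U *m U^T = 1%:M ->
  expmx (conj_diag U d) = conj_diag U (map_mx expR d).
Proof.
move=> U1; apply: cvg_lim; first exact: norm_hausdorff.
have -> : series (fun k => (k`!%:R)^-1 *: conj_diag U d ^+ k) =
    fun N => conj_diag U (map_mx (fun x => series (exp_coeff x) N) d).
  apply/funext => N; rewrite /series/=.
  transitivity (\sum_(0 <= k < N) conj_diag U (map_mx (fun x => exp_coeff x k) d)).
    apply: eq_bigr => k _; rewrite conj_diagX// /conj_diag scalemxAl scalemxAr.
    congr (_ *m _ *m _); apply/matrixP => i j; rewrite !mxE /exp_coeff/=.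
    by rewrite mulrnAr mulrC.
  rewrite /conj_diag -mulmx_suml -mulmx_sumr; congr (_ *m _ *m _).
  apply/matrixP => i j; rewrite summxE !mxE.
  have [->|ij] := eqVneq i j; last by rewrite mulr0n big1// => k _; rewrite !mxE (negPf ij).
  by rewrite mulr1n; apply: eq_bigr => k _; rewrite !mxE eqxx.
apply: cvg_mulmx; last exact: cvg_cst.
apply: cvg_mulmx; first exact: cvg_cst.
apply: cvg_mx => i j; rewrite 2!mxE; under eq_fun do rewrite 2!mxE.
by apply: cvgMn; exact: is_cvg_series_exp_coeff.
Qed.

Lemma expmx_intertwine m n (A : 'M[R]_m) (B : 'M[R]_n) (C : 'M[R]_(m, n)) :
  A^T = A -> B^T = B -> A *m C = C *m B -> expmx A *m C = C *m expmx B.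
Proof.
move=> /symmx_spectral [U [d [U1 ->]]] /symmx_spectral [V [e [V1 ->]]] h.
by rewrite !expmx_conj_diag//; exact: conj_diag_intertwine.
Qed.

End FunctionalCalculus.

(** * Continuity of the matrix exponential and of the spectral norm *)

Section ExpContinuity.
Context {R : realType}.

Lemma normr_expRNB_le (a b : R) : 0 <= a -> 0 <= b ->
  `|expR (- a) - expR (- b)| <= `|a - b|.
Proof.
wlog ab : a b / a <= b => [h a0 b0|].
  by case/orP: (le_total a b) => ?; last rewrite distrC (distrC a); exact: h.
move=> a0 b0.
have h1 : expR (- a) <= 1 by rewrite expR_le1 oppr_le0.
have h2 : expR (- b) <= expR (- a) by rewrite ler_expR lerN2.
have h3 : expR (- a) * (1 + (a - b)) <= expR (- b).
  rewrite [leRHS](_ : _ = expR (- a) * expR (a - b)).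
    by rewrite ler_pM2l ?expR_gt0// expR_ge1Dx.
  by rewrite -expRD; congr expR; ring.
have h4 : expR (- a) * (b - a) <= b - a by rewrite ler_piMl// subr_ge0.
rewrite distrC ler0_norm ?subr_le0// distrC ger0_norm ?subr_ge0//.
lra.
Qed.

Lemma frob_ge0 m n (A : 'M[R]_(m, n)) : 0 <= frob A.
Proof. exact: sqrtr_ge0. Qed.

Lemma entry_le_frob m n (A : 'M[R]_(m, n)) i j : `|A i j| <= frob A.
Proof.
rewrite /frob -sqrtr_sqr ler_wsqrtr// trTE (bigD1 j)//= (bigD1 i)//= -addrA lerDl.
by rewrite addr_ge0//; do ?(apply: sumr_ge0 => ? _); exact: sqr_ge0.
Qed.

Lemma frob_conj m n (U : 'M[R]_m) (V : 'M[R]_n) (X : 'M[R]_(m, n)) :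
  U *m U^T = 1%:M -> V *m V^T = 1%:M -> frob (U *m X *m V^T) = frob X.
Proof.
move=> /mulmx1C U1 /mulmx1C V1; rewrite /frob !trmx_mul trmxK.
rewrite -!mulmxA mxtrace_mulC -!mulmxA V1 mulmx1.
by rewrite (mulmxA U^T) U1 mul1mx.
Qed.

(** Between the two eigenbases, [f(A) - f(B)] has entries [(f(d_i) - f(e_j)) (U V^T)_ij], so a
    scalar Lipschitz constant passes to the Frobenius norm. *)
Lemma frob_expmxN_le n (A B : 'M[R]_n) : psdmx A -> psdmx B ->
  frob (expmx (- A) - expmx (- B)) <= frob (A - B).
Proof.
move=> /psd_spectral [U [d [U1 AE d0]]] /psd_spectral [V [e [V1 BE e0]]].
have NE (W : 'M[R]_n) (v : 'rV[R]_n) : - conj_diag W v = conj_diag W (- v).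
  by rewrite /conj_diag linearN/= mulmxN mulNmx.
rewrite AE BE 2![in leLHS]NE !expmx_conj_diag//.
have conjE (v w : 'rV[R]_n) i j : (U *m (conj_diag U v - conj_diag V w) *m V^T) i j =
    (v 0 i - w 0 j) * (U *m V^T) i j.
  have -> : U *m (conj_diag U v - conj_diag V w) *m V^T =
      diag_mx v *m (U *m V^T) - (U *m V^T) *m diag_mx w.
    rewrite /conj_diag mulmxBr mulmxBl !mulmxA U1 mul1mx; congr (_ - _).
    by rewrite -(mulmxA _ V V^T) V1 mulmx1.
  by rewrite mul_diag_mx mul_mx_diag mxE [X in X + _ = _]mxE [X in _ + X = _]mxE [X in _ - X = _]mxE mulrBl [X in _ - X = _]mulrC.
rewrite -[leLHS](frob_conj _ U1 V1) -[leRHS](frob_conj _ U1 V1).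
rewrite /frob ler_wsqrtr// !trTE; apply: ler_sum => j _; apply: ler_sum => i _.
rewrite !conjE !exprMn ler_wpM2r ?sqr_ge0// 4!mxE.
rewrite -[leLHS]real_normK ?num_real// -[leRHS]real_normK ?num_real//.
by rewrite ler_sqr ?nnegrE ?normr_ge0// normr_expRNB_le.
Qed.

Lemma cvg_frob_sub {T : Type} (F : set_system T) {FF : Filter F} m n
    (f : T -> 'M[R]_(m, n)) (A : 'M[R]_(m, n)) :
  (f x @[x --> F] --> A)%classic -> (frob (f x - A) @[x --> F] --> (0 : R))%classic.
Proof.
move=> fA; rewrite -(@sqrtr0 R).
apply: continuous_cvg; first exact: sqrt_continuous.
have -> : (0 : R) = \sum_(j < n) \sum_(i < m) 0 ^+ 2.
  by rewrite expr0n/= big1// => j _; rewrite big1.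
under eq_fun do rewrite trTE.
apply: cvg_big_sum => j; apply: cvg_big_sum => i; rewrite -(subrr (A i j)).
under eq_fun do rewrite !mxE.
by apply: cvgM; (apply: cvgB; [exact: cvg_mx_entry|exact: cvg_cst]).
Qed.

Lemma cvg_of_frob_le {T : Type} (F : set_system T) {FF : Filter F} m n p q
    (f : T -> 'M[R]_(m, n)) (A : 'M[R]_(m, n))
    (g : T -> 'M[R]_(p, q)) (B : 'M[R]_(p, q)) :
  (forall x, frob (g x - B) <= frob (f x - A)) ->
  (f x @[x --> F] --> A)%classic -> (g x @[x --> F] --> B)%classic.
Proof.
move=> gf fA; apply: cvg_mx => i j; apply/cvgrPdist_le => e e0.
have h0 := cvg_frob_sub (FF := FF) fA; move/cvgrPdist_le/(_ _ e0): h0.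
apply: filterS => x; rewrite sub0r normrN ger0_norm ?frob_ge0// => h.
rewrite distrC; apply: le_trans h; apply: le_trans (gf x).
by have := entry_le_frob (g x - B) i j; rewrite !mxE.
Qed.

Lemma cvg_expmxN {T : Type} (F : set_system T) {FF : Filter F} n
    (f : T -> 'M[R]_n) (A : 'M[R]_n) :
  psdmx A -> (forall x, psdmx (f x)) -> (f x @[x --> F] --> A)%classic ->
  (expmx (- f x) @[x --> F] --> expmx (- A))%classic.
Proof.
by move=> pA pf; apply: cvg_of_frob_le => x; exact: frob_expmxN_le.
Qed.

Lemma cvg_spectral_norm {T : Type} (F : set_system T) {FF : Filter F} m n
    (f : T -> 'M[R]_(m, n)) (A : 'M[R]_(m, n)) :
  (f x @[x --> F] --> A)%classic ->
  (spectral_norm (f x) @[x --> F] --> spectral_norm A)%classic.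
Proof.
move=> fA; apply/cvgrPdist_le => e e0.
have h0 := cvg_frob_sub (FF := FF) fA; move/cvgrPdist_le/(_ _ e0): h0.
apply: filterS => x; rewrite sub0r normrN ger0_norm ?frob_ge0// => h.
by rewrite distrC; apply: le_trans h; exact: spectral_normB_le.
Qed.

End ExpContinuity.

(** * The error of a compressed semigroup *)

Section Galerkin.
Context {R : realType}.

(** Here [c] is an overlap of eigenvectors and [e] the matching entry of the residual. If [a = b],
    the hypothesis forces [a^2 e = 0] and both sides vanish. *)
Lemma kernel_some (a b c e : R) : a * c = b * c - a * b * e ->
  (expR (- a) - expR (- b)) * c = exp_kernel (Some a) (Some b) * e.
Proof.
rewrite /exp_kernel; have [<- h|ab h] := eqVneq a b.
  rewrite subrr mul0r; have aae : a * a * e = 0 by lra.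
  by rewrite mulrAC expr2 aae mul0r.
have ba : b - a != 0 by rewrite subr_eq0 eq_sym.
rewrite mulrAC [a * b * _ * e]mulrAC; apply: (mulIf ba); rewrite mulfVK//.
have -> : a * b * e = (b - a) * c by rewrite mulrBl h; ring.
ring.
Qed.

Lemma kernel_none (a c e : R) : c = a * e ->
  expR (- a) * c = exp_kernel (Some a) None * e.
Proof. by move=> ->; rewrite /= mulrCA mulrA. Qed.

Lemma contractive_mx m n (B : 'M[R]_(m, n)) :
  (forall x y, (x^T *m B *m y) 0 0 <= (sqn x + sqn y) / 2) -> contractive B.
Proof.
move=> h x y; have := h (\col_i x i) (\col_j y j).
have -> : sqn (\col_i x i) = \sum_i x i ^+ 2.
  by apply: eq_bigr => i _; rewrite mxE.
have -> : sqn (\col_j y j) = \sum_j y j ^+ 2.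
  by apply: eq_bigr => i _; rewrite mxE.
suff -> : bilin B x y = ((\col_i x i)^T *m B *m \col_j y j) 0 0 by [].
rewrite /bilin mxE exchange_big /=; apply: eq_bigr => j _.
by rewrite !mxE mulr_suml; apply: eq_bigr => i _; rewrite !mxE.
Qed.

Lemma mxtrace_frame m n q (U : 'M[R]_m) (F : 'M[R]_(n, q)) (D : 'M[R]_(m, n))
    (X : 'M[R]_(n, m)) :
  U^T *m U = 1%:M -> F *m F^T = 1%:M ->
  \tr (D *m X) = \sum_i \sum_j (U *m D *m F) i j * (F^T *m X *m U^T) j i.
Proof.
move=> U1 F1.
have -> : \tr (D *m X) = \tr ((U *m D *m F) *m (F^T *m X *m U^T)).
  rewrite !mulmxA -(mulmxA _ F) F1 mulmx1 [in RHS]mxtrace_mulC.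
  by rewrite !mulmxA U1 mul1mx.
by apply: eq_bigr => i _; rewrite mxE.
Qed.

(** The hypotheses say that the range of [V] is [L]-orthogonal to that of [E] and contains the range
    of [1 - E L]. Both bounds come from [schur_kernel] with exchanged roles: for the spectral norm
    [B] is the normalized [E] and the vectors are test vectors, for the nuclear norm [B] is a dual
    contraction and the vectors come from a square root of [E]. *)
Theorem galerkin_bound n k (L E : 'M[R]_n) (V : 'M[R]_(n, k)) :
  psdmx L -> psdmx E -> V^T *m V = 1%:M -> E *m L *m V = 0 ->
  V *m V^T *m (1%:M - E *m L) = 1%:M - E *m L ->
  let D := expmx (- L) - V *m expmx (- (V^T *m L *m V)) *m V^T in
  spectral_norm D <= lip_const * spectral_norm E /\
  nuclear_norm D <= lip_const * \tr E.
Proof.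
move=> pL pE V1 ELV VEL; set M := V^T *m L *m V => D.
have pM : psdmx M.
  split=> [|x]; first by rewrite !trmx_mul trmxK pL.1 mulmxA.
  by have := pL.2 (V *m x); rewrite trmx_mul /M !mulmxA.
have symL := pL.1; have symE := pE.1.
have [U [d [U1 LE d0]]] := psd_spectral pL.
have [Q [m [Q1 ME m0]]] := psd_spectral pM.
have U1' := mulmx1C U1; have Q1' := mulmx1C Q1.
have NE j (W : 'M[R]_j) (v : 'rV[R]_j) : - conj_diag W v = conj_diag W (- v).
  by rewrite /conj_diag linearN/= mulmxN mulNmx.
have eL : expmx (- L) = conj_diag U (map_mx expR (- d)).
  by rewrite LE NE expmx_conj_diag.
have eM : expmx (- M) = conj_diag Q (map_mx expR (- m)).
  by rewrite ME NE expmx_conj_diag.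
have [P Pdef] : {P | P = V *m V^T} by exists (V *m V^T).
rewrite -Pdef in VEL.
have symP : P^T = P by rewrite Pdef trmx_mul trmxK.
have PP : P *m P = P by rewrite Pdef mulmxA -(mulmxA V) V1 mulmx1.
have LEP : (1%:M - L *m E) *m P = 1%:M - L *m E.
  apply: trmx_inj; rewrite trmx_mul symP linearB/= trmx1 trmx_mul symL symE.
  exact: VEL.
have [V' V'def] : {V' | V' = V *m Q^T} by exists (V *m Q^T).
have V'm : V' *m diag_mx m = P *m L *m V'.
  have -> : P *m L *m V' = V *m M *m Q^T by rewrite Pdef V'def /M !mulmxA.
  by rewrite ME /conj_diag V'def !mulmxA -(mulmxA _ Q Q^T) Q1 mulmx1.
(* [1 - L E] fixes [L V'] because [E L V = 0], and it absorbs [P] on its right; this gives the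
   relation needed by [kernel_some]. *)
have LV' : L *m V' = V' *m diag_mx m - L *m E *m (V' *m diag_mx m).
  rewrite V'm -{1}(mul1mx (P *m L *m V')) -mulmxBl !mulmxA LEP.
  rewrite mulmxBl mul1mx mulmxBl -(mulmxA L E L) -(mulmxA L) V'def (mulmxA (E *m L)).
  by rewrite ELV mul0mx mulmx0 subr0.
(* The analogue on the complement of the range of [V], as needed by [kernel_none]. *)
have LE1P : 1%:M - P = L *m E *m (1%:M - P).
  apply/eqP; rewrite -subr_eq0 -{1}(mul1mx (1%:M - P)) -mulmxBl mulmxBr mulmx1.
  by rewrite LEP subrr.
have UL : U *m L = diag_mx d *m U by rewrite LE /conj_diag !mulmxA U1 mul1mx.
have UeL : U *m expmx (- L) = diag_mx (map_mx expR (- d)) *m U.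
  by rewrite eL /conj_diag !mulmxA U1 mul1mx.
(* A Parseval frame: an orthonormal basis of the range of [V] made of
   eigenvectors, and a redundant family spanning its complement. *)
pose F := row_mx V' (1%:M - P) : 'M[R]_(n, k + n).
have F1 : F *m F^T = 1%:M.
  rewrite /F tr_row_mx mul_row_col linearB/= trmx1 symP.
  rewrite mulmxBl mul1mx mulmxBr mulmx1 PP subrr subr0.
  by rewrite V'def trmx_mul trmxK mulmxA -(mulmxA V) Q1' mulmx1 -Pdef addrC subrK.
pose b (j : 'I_(k + n)) := if fintype.split j is inl l then Some (m 0 l) else None.
have b0 j : ext_nonneg (b j) by rewrite /b; case: (fintype.split j).
pose a (i : 'I_n) := Some (d 0 i).
have mE q (v : 'rV[R]_q) l : map_mx expR (- v) 0 l = expR (- v 0 l) by rewrite !mxE.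
have kE i j : (U *m D *m F) i j = exp_kernel (a i) (b j) * (U *m E *m F) i j.
  rewrite /F !mul_mx_row /b -{1 3}(fintype.splitK j); case: (fintype.split j) => l /=.
    rewrite !row_mxEl.
    have -> : U *m D *m V' =
        diag_mx (map_mx expR (- d)) *m (U *m V') - (U *m V') *m diag_mx (map_mx expR (- m)).
      rewrite /D mulmxBr mulmxBl UeL -!mulmxA; congr (_ - _); congr (_ *m _).
      rewrite V'def !mulmxA -(mulmxA _ V^T V) V1 mulmx1 eM /conj_diag !mulmxA.
      by rewrite -(mulmxA _ Q Q^T) Q1 mulmx1.
    rewrite mul_diag_mx mul_mx_diag; have [c cdef] : {c | c = U *m V'} by exists (U *m V').
    rewrite -cdef mxE [X in X + _ = _]mxE [X in _ + X = _]mxE [X in _ - X = _]mxE !mE.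
    rewrite [X in _ - X]mulrC -mulrBl.
    apply: kernel_some.
    have : diag_mx d *m c = c *m diag_mx m - diag_mx d *m (U *m E *m V') *m diag_mx m.
      rewrite cdef mulmxA -UL -mulmxA LV' mulmxBr !mulmxA; congr (_ - _).
      by rewrite -UL.
    move: (U *m E *m V') => e /matrixP/(_ i l).
    rewrite !mul_mx_diag !mul_diag_mx !mxE => ->; ring.
  rewrite !row_mxEr.
  have -> : U *m D *m (1%:M - P) = diag_mx (map_mx expR (- d)) *m (U *m (1%:M - P)).
    rewrite /D [U *m _]mulmxBr mulmxBl UeL -!mulmxA.
    have -> : V^T *m (1%:M - P) = 0.
      by rewrite mulmxBr mulmx1 Pdef mulmxA V1 mul1mx subrr.
    by rewrite !mulmx0 subr0.
  rewrite mul_diag_mx mxE mE.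
  apply: kernel_none.
  by rewrite {1}LE1P !mulmxA UL -!mulmxA mul_diag_mx mxE !mulmxA.
have lip0 : 0 <= lip_const :> R := lip_const_ge0.
have a0 i : ext_nonneg (a i) by exact: d0.
split.
(* Normalizing by the norm of [E] requires it to be nonzero; otherwise [E = 0] and the entrywise
   formula gives [D = 0]. *)
- have [s0|s0] := eqVneq (spectral_norm E) 0.
    have E0 : E = 0.
      apply/trmx_inj/row_matrixP => i; rewrite trmx0 row0 rowE -[RHS]trmx0; apply: trmx_inj.
      rewrite trmxK trmx_mul trmxK; apply: norm2_eq0; apply: le_anti.
      by rewrite norm2_ge0 andbT (le_trans (norm2_mul_le _ _))// s0 mul0r.
    have G0 : U *m D *m F = 0.
      by apply/matrixP => i j; rewrite kE E0 mulmx0 mul0mx !mxE mulr0.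
    have -> : D = 0.
      transitivity (U^T *m (U *m D *m F) *m F^T); last by rewrite G0 mulmx0 mul0mx.
      by rewrite !mulmxA U1' mul1mx -mulmxA F1 mulmx1.
    rewrite s0 mulr0; apply: spectral_norm_le => // x.
    by rewrite mul0mx norm2_0 mul0r.
  apply: spectral_norm_le_bilinear => [|x y].
    by rewrite mulr_ge0 ?spectral_norm_ge0.
  pose B := (spectral_norm E)^-1 *: (U *m E *m F).
  have cB : contractive B.
    apply: contractive_mx => {}x {}y.
    rewrite -scalemxAr -scalemxAl mxE mulrC ler_pdivrMr; last first.
      by rewrite lt_def s0 spectral_norm_ge0.
    have := form_le_spectral_norm E (U^T *m x) (F *m y).
    rewrite trmx_mul trmxK !mulmxA mulrC => /le_trans; apply.
    rewrite ler_wpM2r ?spectral_norm_ge0// ler_pM2r//.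
    apply: lerD; last exact: sqn_mul_coisometry.
    by rewrite sqn_mul_orth// trmxK.
  have := schur_kernel (fun i => (U *m x) i 0) (fun j => (F^T *m y) j 0) cB a0 b0.
  have -> : energy (fun i => (U *m x) i 0) (fun j => (F^T *m y) j 0) =
      (sqn x + sqn y) / 2.
    rewrite -(sqn_mul_orth x U1') -(@sqn_mul_orth _ _ _ F^T y)//.
    by rewrite trmxK.
  have -> : (x^T *m D *m y) 0 0 = \tr (D *m (y *m x^T)).
    by rewrite mulmxA mxtrace_mulC mulmxA trace_mx11.
  have -> : \tr (D *m (y *m x^T)) = spectral_norm E *
      \sum_i \sum_j exp_kernel (a i) (b j) * ((U *m x) i 0 * B i j * (F^T *m y) j 0).
    rewrite (mxtrace_frame _ _ U1' F1) mulr_sumr; apply: eq_bigr => i _.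
    rewrite mulr_sumr; apply: eq_bigr => j _; rewrite kE.
    have -> : (F^T *m (y *m x^T) *m U^T) j i = (F^T *m y) j 0 * (U *m x) i 0.
      have -> : F^T *m (y *m x^T) *m U^T = (F^T *m y) *m (U *m x)^T.
        by rewrite trmx_mul !mulmxA.
      by rewrite mxE big_ord1 [_^T 0 i]mxE.
    rewrite /B [X in _ * (_ * X * _)]mxE.
    set e := (U *m E *m F) i j; set p := (U *m x) i 0; set q := (F^T *m y) j 0.
    by field.
  by move=> hS; rewrite -[leRHS]mulrA [leRHS]mulrCA ler_pM2l// lt_def s0 spectral_norm_ge0.
- have symD : D^T = D.
    by rewrite /D eL eM linearB/= tr_conj_diag 2!trmx_mul trmxK tr_conj_diag mulmxA.
  have [X -> cX] := nuclear_norm_dual symD.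
  have [[symS _] SS] := sqrtmxP pE.
  have [S Sdef] : {S | S = sqrtmx E} by exists (sqrtmx E).
  rewrite -Sdef in symS SS.
  pose B := (F^T *m X *m U^T)^T.
  have cB : contractive B.
    apply: contractive_mx => x y.
    have := cX (F *m y) (U^T *m x).
    have -> : (F *m y)^T *m X *m (U^T *m x) = (x^T *m B *m y)^T.
      by rewrite /B !trmx_mul !trmxK !mulmxA.
    rewrite [leLHS]mxE => /le_trans; apply; rewrite ler_pM2r// addrC.
    apply: lerD; last exact: sqn_mul_coisometry.
    by rewrite sqn_mul_orth// trmxK.
  have -> : \tr (D *m X) = \sum_l \sum_i \sum_j
      exp_kernel (a i) (b j) * ((U *m S) i l * B i j * (S *m F) l j).
    rewrite (mxtrace_frame _ _ U1' F1) [RHS]exchange_big; apply: eq_bigr => i _.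
    rewrite [RHS]exchange_big; apply: eq_bigr => j _; rewrite kE.
    have -> : U *m E *m F = (U *m S) *m (S *m F) by rewrite -SS !mulmxA.
    rewrite [((U *m S) *m _) i j]mxE mulr_sumr mulr_suml; apply: eq_bigr => l _.
    have -> : B i j = (F^T *m X *m U^T) j i by rewrite mxE.
    by ring.
  (* The squared Frobenius norm of [S] is [\tr E], and neither [U] nor the Parseval frame changes
     it, so the energies of the rank-one pieces add up to [\tr E]. *)
  have -> : lip_const * \tr E = \sum_l lip_const *
      energy (fun i => (U *m S) i l) (fun j => (S *m F) l j).
    rewrite -mulr_sumr; congr (_ * _); rewrite /energy -mulr_suml big_split/=.
    have -> : \sum_l \sum_i (U *m S) i l ^+ 2 = \tr E.
      by rewrite -trTE trmx_mul symS mulmxA -(mulmxA S) U1' mulmx1 SS.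
    have -> : \sum_l \sum_j (S *m F) l j ^+ 2 = \tr E.
      rewrite exchange_big /= -trTE mxtrace_mulC trmx_mul symS mulmxA -(mulmxA S) F1.
      by rewrite mulmx1 SS.
    by field.
  by apply: ler_sum => l _; exact: schur_kernel.
Qed.

End Galerkin.

(** * The Nystrom residual and its limit *)

Section Definite.
Context {R : realType}.

Lemma definite_unitmx n (A : 'M[R]_n) :
  (forall x : 'cV_n, (x^T *m A *m x) 0 0 = 0 -> x = 0) -> A \in unitmx.
Proof.
move=> h; rewrite unitmxE unitfE; apply/det0P => -[v v0 vA].
move/negP: v0; apply; apply/eqP/trmx_inj; rewrite trmx0; apply: h.
by rewrite trmxK vA mul0mx mxE.
Qed.

Lemma invmx_eq n (A B : 'M[R]_n) : A *m B = 1%:M -> invmx A = B.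
Proof.
by move=> AB; have [uA _] := mulmx1_unit AB; rewrite -(mulKmx uA B) AB mulmx1.
Qed.

Lemma invmxM n (A B : 'M[R]_n) : A \in unitmx -> B \in unitmx ->
  invmx (A *m B) = invmx B *m invmx A.
Proof.
by move=> uA uB; apply: invmx_eq; rewrite -mulmxA mulKVmx// mulmxV.
Qed.

Lemma psd_scale n (A : 'M[R]_n) c : 0 <= c -> psdmx A -> psdmx (c *: A).
Proof.
move=> c0 [symA posA]; split=> [|x]; first by rewrite linearZ/= symA.
by rewrite -scalemxAr -scalemxAl mxE mulr_ge0.
Qed.

Lemma psd_congr m n (A : 'M[R]_m) (B : 'M[R]_(m, n)) :
  psdmx A -> psdmx (B^T *m A *m B).
Proof.
move=> [symA posA]; split=> [|x]; first by rewrite !trmx_mul trmxK symA mulmxA.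
by have := posA (B *m x); rewrite trmx_mul !mulmxA.
Qed.

Lemma quad_shifted n (L : 'M[R]_n) g (x : 'cV_n) :
  (x^T *m shifted L g *m x) 0 0 = (x^T *m L *m x) 0 0 + g * sqn x.
Proof.
by rewrite /shifted mulmxDr mulmxDl mul_mx_scalar -scalemxAl sqnE !mxE.
Qed.

Lemma psd_shifted n (L : 'M[R]_n) g : 0 <= g -> psdmx L -> psdmx (shifted L g).
Proof.
move=> g0 [symL posL]; split=> [|x].
  by rewrite /shifted linearD/= symL tr_scalar_mx.
by rewrite quad_shifted addr_ge0// mulr_ge0// sqn_ge0.
Qed.

End Definite.

Section Nystrom.
Context {R : realType} {n : nat}.
Variables (L : 'M[R]_n) (I : {set 'I_n}).
Hypothesis psdL : psdmx L.

(** Turns the extraction of columns, rows and minors into products; [P] and [Q] below are the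
    coordinate projections on [I] and its complement. *)
Definition selector : 'M[R]_(n, #|I|) := cols I 1%:M.
Local Notation S := selector.
Local Notation P := (S *m S^T).
Local Notation Q := (1%:M - P).

Hypothesis defL : forall x : 'cV_n, S^T *m x = 0 -> (x^T *m L *m x) 0 0 = 0 -> x = 0.

Lemma colsE (K : 'M[R]_n) : cols I K = K *m S.
Proof. by rewrite /S /cols mulmx_colsub mulmx1. Qed.

Lemma tr_selector : S^T = rows I 1%:M.
Proof. by apply/matrixP => i j; rewrite !mxE eq_sym. Qed.

Lemma rowsE (K : 'M[R]_n) : rows I K = S^T *m K.
Proof. by rewrite tr_selector /rows mul_rowsub_mx mul1mx. Qed.

Lemma minorE (K : 'M[R]_n) : minor I K = S^T *m K *m S.
Proof.
rewrite -mulmxA -colsE tr_selector /rows /cols -mxsub_mul.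
by rewrite mul1mx.
Qed.

Lemma selectorK : S^T *m S = 1%:M.
Proof.
rewrite tr_selector /S /rows /cols -mxsub_mul mulmx1.
by apply/matrixP => i j; rewrite !mxE (inj_eq enum_val_inj).
Qed.

(** The submatrix off [I], completed by the identity on [I] so that it can be inverted in size
    [n]. *)
Definition block g : 'M[R]_n := P + Q *m shifted L g *m Q.
(* The inverse of the block of [shifted L g] off [I], padded with zeros. *)
Definition schur_inv g : 'M[R]_n := Q *m invmx (block g) *m Q.
(* Column [j] is the [L_g]-harmonic extension of the indicator of the [j]-th
   element of [I]. *)
Definition dirichlet_ext g : 'M[R]_(n, #|I|) := (1%:M - schur_inv g *m shifted L g) *m S.

Lemma trP : P^T = P. Proof. by rewrite trmx_mul trmxK. Qed.
Lemma PP : P *m P = P. Proof. by rewrite mulmxA -(mulmxA S) selectorK mulmx1. Qed.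
Lemma trQ : Q^T = Q. Proof. by rewrite linearB/= trmx1 trP. Qed.
Lemma PQ : P *m Q = 0. Proof. by rewrite mulmxBr mulmx1 PP subrr. Qed.
Lemma QP : Q *m P = 0. Proof. by rewrite mulmxBl mul1mx PP subrr. Qed.
Lemma QQ : Q *m Q = Q. Proof. by rewrite mulmxBr mulmx1 QP subr0. Qed.
Lemma QS : Q *m S = 0.
Proof. by rewrite mulmxBl mul1mx -mulmxA selectorK mulmx1 subrr. Qed.
Lemma STQ : S^T *m Q = 0.
Proof. by rewrite mulmxBr mulmx1 mulmxA selectorK mul1mx subrr. Qed.

Section Shift.
Variable g : R.
Hypothesis g0 : 0 <= g.
Local Notation Lg := (shifted L g).
Local Notation B := (block g).
Local Notation E := (schur_inv g).
Local Notation Z := (dirichlet_ext g).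

Lemma psdLg : psdmx Lg. Proof. exact: psd_shifted. Qed.

Lemma symLg : Lg^T = Lg. Proof. exact: psdLg.1. Qed.

(** The form splits into [|S^T x|^2] and the shifted form at [Q x]; both vanish only at 0, by
    [defL], even at [g = 0]. *)
Lemma block_unit : B \in unitmx.
Proof.
apply: definite_unitmx => x.
have -> : (x^T *m B *m x) 0 0 = sqn (S^T *m x) +
    (((Q *m x)^T *m L *m (Q *m x)) 0 0 + g * sqn (Q *m x)).
  rewrite -quad_shifted sqnE !trmx_mul trmxK trQ /block mulmxDr mulmxDl mxE.
  by rewrite !mulmxA.
have h2 : 0 <= ((Q *m x)^T *m L *m (Q *m x)) 0 0 by exact: psdL.2.
have h3 : 0 <= g * sqn (Q *m x) by rewrite mulr_ge0 ?sqn_ge0.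
move/eqP; rewrite paddr_eq0 ?sqn_ge0 ?addr_ge0// paddr_eq0//.
move=> /and3P [/eqP/sqn_eq0 Sx /eqP Qx _].
have : Q *m x = 0 by apply: defL => //; rewrite mulmxA STQ mul0mx.
by rewrite mulmxBl mul1mx -mulmxA Sx mulmx0 subr0.
Qed.

Lemma tr_block : B^T = B.
Proof. by rewrite /block linearD/= !trmx_mul trQ symLg trmxK mulmxA. Qed.

Lemma blockQ : B *m Q = Q *m Lg *m Q.
Proof. by rewrite /block [LHS]mulmxDl PQ add0r -!mulmxA QQ. Qed.

Lemma Qblock : Q *m B = Q *m Lg *m Q.
Proof. by rewrite /block [LHS]mulmxDr QP add0r !mulmxA QQ. Qed.

Lemma schur_invE : E = invmx B *m Q.
Proof.
have u := block_unit.
have h : Q *m invmx B = invmx B *m Q.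
  by rewrite -[LHS](mulKmx u) (mulmxA B) blockQ -Qblock -mulmxA mulmxV// mulmx1.
by rewrite /schur_inv h -mulmxA QQ.
Qed.

Lemma tr_schur_inv : E^T = E.
Proof. by rewrite /schur_inv !trmx_mul trQ trmx_inv tr_block mulmxA. Qed.

Lemma schur_invQ : E *m Q = E.
Proof. by rewrite schur_invE -mulmxA QQ. Qed.

Lemma Qschur_inv : Q *m E = E.
Proof. by rewrite /schur_inv !mulmxA QQ. Qed.

(** Together with [ELQ] and [ELE], this makes [E *m Lg] the [Lg]-orthogonal projection onto the
    vectors supported off [I]; [1 - E Lg] projects onto the range of [Z]. *)
Lemma QLE : Q *m Lg *m E = Q.
Proof.
by rewrite -Qschur_inv mulmxA -blockQ -mulmxA Qschur_inv schur_invE mulKVmx ?block_unit.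
Qed.

Lemma ELQ : E *m Lg *m Q = Q.
Proof. by apply: trmx_inj; rewrite 2!trmx_mul trQ symLg tr_schur_inv mulmxA QLE. Qed.

Lemma ELE : E *m Lg *m E = E.
Proof.
transitivity (E *m (Q *m Lg *m E)); last by rewrite QLE schur_invQ.
by rewrite !mulmxA schur_invQ.
Qed.

Lemma psd_schur_inv : psdmx E.
Proof.
by rewrite -ELE -{1}tr_schur_inv; apply: psd_congr; exact: psdLg.
Qed.

Lemma dirichlet_extE : Z *m S^T = 1%:M - E *m Lg.
Proof.
rewrite /dirichlet_ext -mulmxA; apply/eqP; rewrite eq_sym -subr_eq0.
rewrite -{1}[1%:M - E *m Lg]mulmx1 -mulmxBr mulmxBl mul1mx ELQ.
by rewrite subrr.
Qed.

Lemma ELZ : E *m Lg *m Z = 0.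
Proof.
rewrite /dirichlet_ext mulmxA [_ *m (1%:M - _)]mulmxBr mulmx1 [E *m Lg *m _]mulmxA.
by rewrite ELE subrr mul0mx.
Qed.

Lemma STZ : S^T *m Z = 1%:M.
Proof.
have SE : S^T *m E = 0.
  by rewrite -Qschur_inv mulmxA STQ mul0mx.
by rewrite /dirichlet_ext mulmxA [_ *m (1%:M - _)]mulmxBr mulmx1 mulmxA SE mul0mx subr0 selectorK.
Qed.

Lemma dirichlet_gram_unit : Z^T *m Z \in unitmx.
Proof.
apply: definite_unitmx => x; rewrite mulmxA -trmx_mul -mulmxA -sqnE => /sqn_eq0 Zx.
by rewrite -[x]mul1mx -STZ -mulmxA Zx mulmx0.
Qed.

Definition dirichlet_proj : 'M[R]_n := Z *m invmx (Z^T *m Z) *m Z^T.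

Lemma dirichlet_projZ : dirichlet_proj *m Z = Z.
Proof.
by rewrite /dirichlet_proj -(mulmxA _ Z^T) mulmxKV ?dirichlet_gram_unit.
Qed.

Lemma orth_dirichletP :
  [/\ (orthmx Z)^T *m orthmx Z = 1%:M, orthmx Z *m (orthmx Z)^T = dirichlet_proj
    & E *m Lg *m orthmx Z = 0].
Proof.
have [V1 VV] := orthmxP dirichlet_gram_unit.
by split=> //; rewrite /orthmx mulmxA ELZ mul0mx.
Qed.

(** Replacing [Lg] by [t Lg] and [E] by [E / t] leaves their product unchanged; this is the source
    of the factor [1 / t]. *)
Lemma galerkin_dirichlet t : 0 < t ->
  let V := orthmx Z in
  let D := expmx (- (t *: Lg)) - V *m expmx (- (t *: (V^T *m Lg *m V))) *m V^T in
  spectral_norm D <= lip_const * (spectral_norm E / t) /\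
  nuclear_norm D <= lip_const * (\tr E / t).
Proof.
move=> t0; have [V1 VV ELV] := orth_dirichletP; set V := orthmx Z => D.
have tE : (t^-1 *: E) *m (t *: Lg) = E *m Lg.
  by rewrite -scalemxAr -scalemxAl scalerA mulfV ?scale1r// gt_eqF.
have := @galerkin_bound R n _ (t *: Lg) (t^-1 *: E) V _ _ V1.
rewrite tE ELV VV -scalemxAr -scalemxAl => /(_ _ _ erefl).
have -> : dirichlet_proj *m (1%:M - E *m Lg) = 1%:M - E *m Lg.
  by rewrite -dirichlet_extE mulmxA dirichlet_projZ.
case=> //.
- by apply: psd_scale; [exact: ltW|exact: psdLg].
- by apply: psd_scale; [rewrite invr_ge0 ltW|exact: psd_schur_inv].
move=> h1 h2; split.
  apply: (le_trans h1); rewrite ler_wpM2l ?lip_const_ge0//.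
  apply: spectral_norm_le => [|x]; first by rewrite divr_ge0 ?spectral_norm_ge0 ?ltW.
  rewrite -scalemxAl norm2Z gtr0_norm ?invr_gt0// [leLHS]mulrC [leRHS]mulrAC.
  by rewrite ler_pM2r ?invr_gt0// norm2_mul_le.
by apply: (le_trans h2); rewrite mxtraceZ [t^-1 * _]mulrC.
Qed.

End Shift.
End Nystrom.

(** * Identification of the compression and the residual at a positive shift *)

Section Resolvent.
Context {R : realType} {n : nat}.
Variables (L : 'M[R]_n) (I : {set 'I_n}).
Hypothesis psdL : psdmx L.
Local Notation S := (@selector R n I).
Hypothesis defL : forall x : 'cV_n, S^T *m x = 0 -> (x^T *m L *m x) 0 0 = 0 -> x = 0.

(** [V] intertwines the compressed operator with its extension to the whole space. The right side
    involves only the projection [V *m V^T], not the choice of basis. *)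
Lemma expmx_compress k (A : 'M[R]_n) (V : 'M[R]_(n, k)) t :
  A^T = A -> V^T *m V = 1%:M ->
  V *m expmx (- (t *: (V^T *m A *m V))) *m V^T =
  expmx (- (t *: (V *m V^T *m A *m (V *m V^T)))) *m (V *m V^T).
Proof.
move=> symA V1; rewrite !mulmxA; congr (_ *m _); symmetry.
apply: expmx_intertwine.
- by rewrite linearN linearZ/= !trmx_mul !trmxK symA !mulmxA.
- by rewrite linearN linearZ/= !trmx_mul !trmxK symA !mulmxA.
- rewrite mulNmx mulmxN -scalemxAl -scalemxAr; congr (- (_ *: _)).
  by rewrite -!mulmxA V1 mulmx1 !mulmxA.
Qed.

Lemma gram_proj_mulr m k (Z : 'M[R]_(m, k)) (M : 'M[R]_k) :
  Z^T *m Z \in unitmx -> M \in unitmx ->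
  (Z *m M)^T *m (Z *m M) \in unitmx /\
  Z *m M *m invmx ((Z *m M)^T *m (Z *m M)) *m (Z *m M)^T =
  Z *m invmx (Z^T *m Z) *m Z^T.
Proof.
move=> uZ uM; have uMT : M^T \in unitmx by rewrite unitmx_tr.
have -> : (Z *m M)^T *m (Z *m M) = M^T *m (Z^T *m Z) *m M.
  by rewrite trmx_mul !mulmxA.
rewrite !unitmx_mul uMT uZ uM; split=> //.
rewrite invmxM ?unitmx_mul ?uMT ?uZ// invmxM// trmx_mul.
move: (invmx (Z^T *m Z)) => W.
by rewrite !mulmxA mulmxK// -(mulmxA _ (invmx M^T)) mulVmx// mulmx1.
Qed.

Section PositiveShift.
Variable g : R.
Hypothesis g0 : 0 < g.
Local Notation Lg := (shifted L g).
Local Notation K := (resolvent L g).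
Local Notation M := (S^T *m K *m S).
Local Notation E := (schur_inv L I g).
Local Notation Z := (dirichlet_ext L I g).
Let g0' : 0 <= g := ltW g0.

Lemma shifted_unit : Lg \in unitmx.
Proof.
apply: definite_unitmx => x; rewrite quad_shifted => /eqP.
rewrite paddr_eq0 ?psdL.2// ?mulr_ge0 ?sqn_ge0// mulf_eq0 (gt_eqF g0)/=.
by case/andP => _ /eqP/sqn_eq0.
Qed.

Lemma tr_resolvent : K^T = K.
Proof. by rewrite trmx_inv (symLg psdL g0'). Qed.

Lemma minor_unit : M \in unitmx.
Proof.
apply: definite_unitmx => x.
have -> : x^T *m M *m x = (K *m (S *m x))^T *m Lg *m (K *m (S *m x)).
  rewrite trmx_mul tr_resolvent -[_ *m Lg *m _]mulmxA (mulmxA Lg) mulmxV ?shifted_unit//.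
  by rewrite mul1mx trmx_mul !mulmxA.
rewrite quad_shifted => /eqP.
rewrite paddr_eq0 ?psdL.2// ?mulr_ge0 ?sqn_ge0// mulf_eq0 (gt_eqF g0)/=.
case/andP => _ /eqP/sqn_eq0 KSx.
have Sx : S *m x = 0.
  by rewrite -(mulKVmx shifted_unit (S *m x)) -/(resolvent L g) KSx mulmx0.
by rewrite -[x]mul1mx -(selectorK (R := R) I) -mulmxA Sx mulmx0.
Qed.

(** The residual [N] is symmetric and vanishes on the columns [I], so [Q N = N]; since [Q S = 0],
    also [Q Lg N = Q]. These two identities characterize [E]. *)
Lemma nystrom_residualE : nystrom_residual K I = E.
Proof.
rewrite /nystrom_residual colsE rowsE minorE.
set N := K - _.
have symN : N^T = N.
  rewrite /N linearB/= !trmx_mul trmxK tr_resolvent trmx_inv !trmx_mul trmxK tr_resolvent.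
  by rewrite !mulmxA.
have NS : N *m S = 0.
  by rewrite /N mulmxBl -(mulmxA _ (S^T *m K)) mulmxKV ?minor_unit// subrr.
have SN : S^T *m N = 0 by apply: trmx_inj; rewrite trmx_mul trmxK symN NS trmx0.
have QN : (1%:M - S *m S^T) *m N = N by rewrite mulmxBl mul1mx -mulmxA SN mulmx0 subr0.
have QLN : (1%:M - S *m S^T) *m Lg *m N = 1%:M - S *m S^T.
  rewrite -mulmxA /N mulmxBr mulmxV ?shifted_unit// !mulmxA mulmxV ?shifted_unit// mul1mx.
  rewrite [LHS]mulmxBr mulmx1 !mulmxA QS !mul0mx subr0//.
rewrite (schur_invE psdL defL g0') -QLN -{2}QN mulmxA -blockQ -mulmxA QN.
by rewrite mulKmx ?(block_unit psdL defL g0').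
Qed.

(** The resolvent columns and [Z] span the same space, and [Z] has a limit at zero shift even where
    the resolvent has none. *)
Lemma cols_resolvent : K *m S = Z *m M.
Proof.
have h : E = K - K *m S *m invmx M *m (S^T *m K).
  by rewrite -nystrom_residualE /nystrom_residual colsE rowsE minorE.
have -> : Z = K *m S *m invmx M.
  have KL : K *m Lg = 1%:M by exact: mulVmx shifted_unit.
  rewrite /dirichlet_ext h [(K - _) *m _]mulmxBl KL opprB addrC subrK.
  by rewrite -(mulmxA _ _ Lg) -(mulmxA S^T K Lg) KL mulmx1 -(mulmxA _ S^T S) selectorK mulmx1.
by rewrite mulmxKV ?minor_unit.
Qed.

Lemma compression_atE t : compression_at L I t g =
  expmx (- (t *: (dirichlet_proj L I g *m Lg *m dirichlet_proj L I g)))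
    *m dirichlet_proj L I g.
Proof.
have uZ := dirichlet_gram_unit L I g.
have [uW WE] := gram_proj_mulr uZ minor_unit.
rewrite /compression_at /Defs.basis colsE cols_resolvent.
have [V1 VV] := orthmxP uW.
rewrite scaleNr expmx_compress ?(symLg psdL g0')//.
by rewrite VV WE.
Qed.

End PositiveShift.
End Resolvent.

(** * Passage to zero shift *)

Section Limits.
Context {R : realType} {n : nat}.
Variables (L : 'M[R]_n) (I : {set 'I_n}).
Hypothesis psdL : psdmx L.
Local Notation S := (@selector R n I).
Hypothesis defL : forall x : 'cV_n, S^T *m x = 0 -> (x^T *m L *m x) 0 0 = 0 -> x = 0.

(* The closed forms are defined and continuous for all shifts [g >= 0]; using
   the shift [`|g|] makes them meaningful for all [g]. *)
Lemma lim_at_right0 (T : normedModType R) (f h : R -> T) (l : T) :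
  (forall g, 0 < g -> f g = h `|g|) -> (h `|g| @[g --> 0^'+] --> l)%classic ->
  lim (f g @[g --> 0^'+])%classic = l.
Proof.
move=> fh hl; apply: cvg_lim; first exact: norm_hausdorff.
apply: cvg_trans hl; apply: near_eq_cvg; near=> g.
by rewrite fh//; near: g; exact: nbhs_right_gt.
Unshelve. all: by end_near. Qed.

Lemma cvg_shifted : (shifted L `|g| @[g --> 0^'+] --> shifted L 0)%classic.
Proof.
apply: cvg_mx => i j; rewrite !mxE; under eq_fun do rewrite !mxE.
apply: cvgD; first exact: cvg_cst.
apply: cvgMn; rewrite -[X in (_ --> X)%classic](@normr0 R R).
apply: cvg_norm; exact: cvg_at_right_filter.
Qed.

Lemma cvg_schur_inv :
  (schur_inv L I `|g| @[g --> 0^'+] --> schur_inv L I 0)%classic.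
Proof.
apply: cvg_mulmx; last exact: cvg_cst.
apply: cvg_mulmx; first exact: cvg_cst.
apply: cvg_invmx => [|g|]; try exact: block_unit.
apply: cvgD; first exact: cvg_cst.
apply: cvg_mulmx; last exact: cvg_cst.
apply: cvg_mulmx; first exact: cvg_cst.
exact: cvg_shifted.
Qed.

Lemma cvg_dirichlet_proj :
  (dirichlet_proj L I `|g| @[g --> 0^'+] --> dirichlet_proj L I 0)%classic.
Proof.
have cZ : (dirichlet_ext L I `|g| @[g --> 0^'+] --> dirichlet_ext L I 0)%classic.
  apply: cvg_mulmx; last exact: cvg_cst.
  apply: cvgB; first exact: cvg_cst.
  by apply: cvg_mulmx; [exact: cvg_schur_inv|exact: cvg_shifted].
apply: cvg_mulmx; last exact: cvg_trmx.
apply: cvg_mulmx => //.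
apply: cvg_invmx => [|g|]; try exact: dirichlet_gram_unit.
by apply: cvg_mulmx => //; exact: cvg_trmx.
Qed.

Lemma nystrom_error2E : nystrom_error2 L I = spectral_norm (schur_inv L I 0).
Proof.
apply: (@lim_at_right0 R^o _ (fun g => spectral_norm (schur_inv L I g))).
  by move=> g g0; rewrite (nystrom_residualE psdL defL g0) gtr0_norm.
exact: cvg_spectral_norm cvg_schur_inv.
Qed.

Lemma nystrom_error_nucE : nystrom_error_nuc L I = \tr (schur_inv L I 0).
Proof.
apply: (@lim_at_right0 R^o _ (fun g => \tr (schur_inv L I g))).
  move=> g g0; rewrite (nystrom_residualE psdL defL g0) gtr0_norm// nuclear_norm_psd//.
  by apply: psd_schur_inv => //; exact: ltW.
by apply: cvg_big_sum => i; apply: cvg_mx_entry; exact: cvg_schur_inv.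
Qed.

Lemma dirichlet_proj_tr g : 0 <= g -> (dirichlet_proj L I g)^T = dirichlet_proj L I g.
Proof.
move=> g0; have [_ <- _] := orth_dirichletP psdL defL g0.
by rewrite trmx_mul trmxK.
Qed.

(** The limit is taken in the form that involves only the projection, whose continuity is known, and
    is read back in the basis at zero shift. *)
Lemma proj_compressionE t : 0 < t -> let V := orthmx (dirichlet_ext L I 0) in
  proj_compression L I t =
  V *m expmx (- (t *: (V^T *m shifted L 0 *m V))) *m V^T.
Proof.
move=> t0 V; have [V1 VV _] := orth_dirichletP psdL defL (lexx 0).
rewrite expmx_compress//; last exact: symLg.
rewrite /V VV.
apply: (@lim_at_right0 'M[R]_n _ (fun g => expmx (- (t *: (dirichlet_proj L I g *m
   shifted L g *m dirichlet_proj L I g))) *m dirichlet_proj L I g)).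
  by move=> g g0; rewrite compression_atE// gtr0_norm.
have psdH g : 0 <= g ->
    psdmx (t *: (dirichlet_proj L I g *m shifted L g *m dirichlet_proj L I g)).
  move=> g0; apply: psd_scale; first exact: ltW.
  by rewrite -{1}dirichlet_proj_tr//; apply: psd_congr; exact: psd_shifted.
apply: cvg_mulmx; last exact: cvg_dirichlet_proj.
apply: cvg_expmxN => [|g|]; try exact: psdH.
apply: cvgZ; first exact: cvg_cst.
apply: cvg_mulmx; last exact: cvg_dirichlet_proj.
by apply: cvg_mulmx; [exact: cvg_dirichlet_proj|exact: cvg_shifted].
Qed.

Theorem compression_bound t : 0 < t ->
  spectral_norm (expmx (- t *: L) - proj_compression L I t)
    <= lip_const * (nystrom_error2 L I / t) /\
  nuclear_norm (expmx (- t *: L) - proj_compression L I t)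
    <= lip_const * (nystrom_error_nuc L I / t).
Proof.
move=> t0; rewrite proj_compressionE// nystrom_error2E nystrom_error_nucE.
have L0 : shifted L 0 = L by rewrite /shifted raddf0 addr0.
have := galerkin_dirichlet psdL defL (lexx 0) t0.
by rewrite /= L0 scaleNr.
Qed.

End Limits.

(** * The Dirichlet form of a reversible chain *)

Section LaplacianForm.
Context {R : realType}.

(** With conductances [w_ij = mu_i Q_ij] and [f = D^-1 x], the form is half the sum of
    [w_ij (f_i - f_j)^2]. If it vanishes, [f] is constant along every edge, and irreducibility
    spreads one zero of [f] to all indices. *)
Lemma laplacian_psd_definite n (L : 'M[R]_n) : is_laplacian L ->
  psdmx L /\ forall x : 'cV_n, (x^T *m L *m x) 0 0 = 0 ->
    forall i0, x i0 0 = 0 -> x = 0.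
Proof.
case=> Q [mu [[Qge0 Q1 Qirr mu0 _ _ db]]] /=.
set D := diag_mx _ => LE.
pose s i := Num.sqrt (mu i 0).
have s0 i : 0 < s i by rewrite sqrtr_gt0.
pose D' := diag_mx (\row_i (s i)^-1).
have DE : D = diag_mx (\row_i s i) by congr diag_mx; apply/rowP => i; rewrite !mxE.
have DD' : D *m D' = 1%:M.
  rewrite DE mulmx_diag -diag_const_mx; congr diag_mx; apply/rowP => i.
  by rewrite !mxE mulfV// gt_eqF.
have iD : invmx D = D' by exact: invmx_eq.
have D'D : D' *m D = 1%:M := mulmx1C DD'.
have [w wdef] : {w | w = diag_mx mu^T *m Q} by exists (diag_mx mu^T *m Q).
have DDE : D *m D = diag_mx mu^T.
  rewrite DE mulmx_diag; congr diag_mx; apply/rowP => i.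
  by rewrite !mxE -expr2 sqr_sqrtr// ltW.
have symw : w^T = w by rewrite wdef trmx_mul tr_diag_mx -db.
have LE' : L = - (D' *m w *m D').
  by rewrite LE iD wdef -DDE !mulmxA D'D mul1mx.
have trD' : D'^T = D' by rewrite tr_diag_mx.
have symL : L^T = L.
  by rewrite LE' linearN/= !trmx_mul trD' symw mulmxA.
have wE i j : w i j = mu i 0 * Q i j by rewrite wdef mul_diag_mx !mxE.
have wC i j : w i j = w j i by rewrite -[in LHS]symw mxE.
have wge0 i j : i != j -> 0 <= w i j.
  by move=> ij; rewrite wE mulr_ge0 ?Qge0// ltW.
have w1 i : \sum_j w i j = 0.
  have /matrixP/(_ i 0) : w *m (const_mx 1 : 'cV_n) = 0 by rewrite wdef -mulmxA Q1 mulmx0.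
  rewrite !mxE => h; rewrite -[RHS]h; apply: eq_bigr => j _.
  by rewrite [const_mx _ _ _]mxE mulr1.
have quadE (x : 'cV_n) : (x^T *m L *m x) 0 0 =
    (\sum_i \sum_j w i j * ((D' *m x) i 0 - (D' *m x) j 0) ^+ 2) / 2.
  set f := D' *m x.
  have -> : x^T *m L *m x = - (f^T *m w *m f).
    by rewrite LE' /f trmx_mul trD' mulmxN mulNmx !mulmxA.
  rewrite mxE mxE.
  have -> : \sum_j (f^T *m w) 0 j * f j 0 = \sum_i \sum_j w i j * (f i 0 * f j 0).
    apply: eq_bigr => j _; rewrite mxE mulr_suml; apply: eq_bigr => i _.
    by rewrite mxE wC; ring.
  have h1 : \sum_i \sum_j w i j * f i 0 ^+ 2 = 0.
    by apply: big1 => i _; rewrite -mulr_suml w1 mul0r.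
  have h2 : \sum_i \sum_j w i j * f j 0 ^+ 2 = 0.
    by rewrite exchange_big; apply: big1 => j _; rewrite -mulr_suml (eq_bigr (w j)) ?w1 ?mul0r.
  have -> : \sum_i \sum_j w i j * (f i 0 - f j 0) ^+ 2 =
      \sum_i \sum_j w i j * f i 0 ^+ 2 + \sum_i \sum_j w i j * f j 0 ^+ 2
      - 2 * \sum_i \sum_j w i j * (f i 0 * f j 0).
    rewrite mulr_sumr -big_split -sumrB; apply: eq_bigr => i _ /=.
    rewrite mulr_sumr -big_split -sumrB; apply: eq_bigr => j _ /=.
    ring.
  by rewrite h1 h2; lra.
have term0 (f : 'cV_n) i j : 0 <= w i j * (f i 0 - f j 0) ^+ 2.
  have [->|ij] := eqVneq i j; first by rewrite subrr expr0n/= mulr0.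
  by rewrite mulr_ge0 ?wge0// sqr_ge0.
split; first split=> // x.
  rewrite quadE divr_ge0//; apply: sumr_ge0 => i _; apply: sumr_ge0 => j _.
  exact: term0.
move=> x; rewrite quadE; set f := D' *m x => q0 i0 xi0.
have fE i : f i 0 = (s i)^-1 * x i 0 by rewrite /f mul_diag_mx !mxE.
have f0 i : f i 0 = 0.
  pose a : {pred 'I_n} := [pred k | f k 0 == 0].
  have ca : fingraph.closed [rel k l | (k != l) && (0 < Q k l)] a.
    move=> k l /= /andP[kl Qkl]; rewrite !inE.
    suff -> : f k 0 = f l 0 by [].
    move/eqP: q0; rewrite mulf_eq0 invr_eq0 pnatr_eq0 orbF.
    rewrite psumr_eq0 => [/allP/(_ k (mem_index_enum _)) /=|? _]; last first.
      by apply: sumr_ge0.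
    rewrite psumr_eq0 => [/allP/(_ l (mem_index_enum _)) /=|? _]; last exact: term0.
    by rewrite mulf_eq0 gt_eqF ?wE ?mulr_gt0//= sqrf_eq0 subr_eq0 => /eqP.
  have := closed_connect ca (Qirr i0 i); rewrite !inE fE xi0 mulr0 eqxx => h.
  by apply/eqP; rewrite -h.
apply/colP => i; rewrite mxE; apply/eqP; have /eqP := f0 i.
by rewrite fE mulf_eq0 invr_eq0 gt_eqF.
Qed.

End LaplacianForm.

Theorem theorem2 (R : realType) (n : nat) (L : 'M[R]_n) (I : {set 'I_n}) (t : R)
    (hL : is_laplacian L) (hI : I != finset.set0) (ht : 0 < t) :
  spectral_norm (expmx (- t *: L) - proj_compression L I t)
    <= 3 * Num.sqrt 3 / (2 * pi) * (nystrom_error2 L I / t) /\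
  nuclear_norm (expmx (- t *: L) - proj_compression L I t)
    <= 3 * Num.sqrt 3 / (2 * pi) * (nystrom_error_nuc L I / t).
Proof.
have [psdL defL] := laplacian_psd_definite hL.
have [i0 i0I] := set0Pn _ hI.
(* A member of [I] supplies the coordinate at which [x] vanishes. *)
have defI (x : 'cV_n) : (@selector R n I)^T *m x = 0 ->
    (x^T *m L *m x) 0 0 = 0 -> x = 0.
  move=> Sx q0; apply: (defL _ q0 i0).
  have /matrixP/(_ (enum_rank_in i0I i0) 0) := Sx.
  by rewrite tr_selector mul_rowsub_mx mul1mx !mxE enum_rankK_in.
have [h1 h2] := compression_bound psdL defI ht.
(* Nonnegative errors allow [lip_const] to be enlarged to the stated constant. *)
have e2 : 0 <= nystrom_error2 L I by rewrite nystrom_error2E// spectral_norm_ge0.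
have en : 0 <= nystrom_error_nuc L I.
  rewrite nystrom_error_nucE//.
  have pE := psd_schur_inv psdL defI (lexx 0).
  have [U [d [U1 -> d0]]] := psd_spectral pE.
  rewrite /conj_diag mxtrace_mulC mulmxA U1 mul1mx mxtrace_diag.
  exact: sumr_ge0.
split; [apply: (le_trans h1)|apply: (le_trans h2)].
  by rewrite ler_wpM2r ?lip_const_le// divr_ge0// ltW.
by rewrite ler_wpM2r ?lip_const_le// divr_ge0// ltW.
Qed.
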